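(* Let $V$ be a finite-dimensional real vector space and let $X\subset V$ be a subset that is closed in some convex subset of $V$. There is a canonical bijection between the set of stratifications $\mathcal{S}$ of $X$ for which $(X,\mathcal{S})$ is locally modelled on fans, and the set of locally polyhedral chamber decompositions $\mathcal{P}$ of $X$. The bijection associates to such a stratification $\mathcal{S}$ the decomposition consisting of the closures in $X$ of the strata of $\mathcal{S}$, and its inverse associates to such a decomposition $\mathcal{P}$ the stratification $\mathcal{S}(\mathcal{P})=\bigcup_{P\in\mathcal{P}}\mathcal{S}(P)$ consisting of the strata of the locally polyhedral sets in $\mathcal{P}$.
   Context: ''$X$ is closed in a convex subset of $V$'' means that there is a convex set $C\subset V$ with $X\subset C$ and $X$ closed in $C$ for the subspace topology. A stratification of a subset $X\subset V$ is a locally finite partition of $X$ into connected, locally closed submanifolds of $V$ (the strata) such that if $\Sigma\neq\Sigma'$ are strata and $\Sigma$ intersects the closure $\overline{\Sigma'}$ of $\Sigma'$ in $X$, then $\Sigma\subset\overline{\Sigma'}$ and $\dim\Sigma<\dim\Sigma'$. Polyhedral complexes and fans: a polyhedral complex in $V$ is a collection $\mathcal{P}$ of non-empty polyhedral sets (finite intersections of closed affine half-spaces) such that (i) the (non-empty) faces of any $P\in\mathcal{P}$ belong to $\mathcal{P}$, and (ii) for any $P,Q\in\mathcal{P}$ that intersect, $P\cap Q$ is a face of both. A fan is a finite polyhedral complex consisting of polyhedral cones (finite intersections of closed linear half-spaces; not necessarily pointed). Its support is the union of its cones; its relatively open cones are the relative interiors $\mathring{\sigma}$ of its cones $\sigma$.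 A stratified subset $(X,\mathcal{S})$ of $V$ is locally modelled on fans if for each $x_0\in X$ there is a fan $\mathcal{F}_{x_0}$ in $V$ and an open neighbourhood $U$ of $x_0$ in $V$ such that the partition of $X\cap U$ by connected components of the sets $\Sigma\cap U$, $\Sigma\in\mathcal{S}$, equals $\{(x_0+\mathring{\sigma})\cap U\mid\mathring{\sigma}\text{ a relatively open cone of }\mathcal{F}_{x_0}\}$. A subset $P\subset V$ is locally polyhedral if for every $x\in P$ there are a polyhedral cone $\sigma_x$ in $V$ and an open neighbourhood $U$ of $x$ in $V$ with $P\cap U=(x+\sigma_x)\cap U$. This cone is unique and denoted $\sigma_x(P)$; let $F_x(P)$ be its minimal face. The stratification $\mathcal{S}(P)$ of $P$ consists of the connected components of the classes of the equivalence relation $x\sim y\iff F_x(P)=F_y(P)$ on $P$ (for a polyhedron, these are the relative interiors of its non-empty faces). A locally polyhedral chamber decomposition of $X$ is a locally finite cover $\mathcal{P}$ of $X$ (with union equal to $X$) consisting of non-empty locally polyhedral subsets of $V$ such that: (i) for each $P\in\mathcal{P}$ and $\Sigma\in\mathcal{S}(P)$, the closure of $\Sigma$ in $X$ belongs to $\mathcal{P}$; (ii) for any $P,Q\in\mathcal{P}$ that intersect, $P\cap Q$ is the closure in $X$ of a common stratum $\Sigma\in\mathcal{S}(P)\cap\mathcal{S}(Q)$. *)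

(* Defs.v *)
From HB Require Import structures.
From mathcomp Require Import all_boot all_order all_algebra.
From mathcomp Require Import all_classical all_reals all_analysis.

Set Implicit Arguments.
Unset Strict Implicit.
Unset Printing Implicit Defensive.

Import Order.TTheory GRing.Theory Num.Theory.
Import numFieldNormedType.Exports.

Local Open Scope classical_set_scope.
Local Open Scope ring_scope.

(* Finite-dimensional normed spaces. All norms on a finite-dimensional real
   vector space are equivalent; the norm only serves to give access to the
   canonical topology and to differential calculus. *)
#[short(type="normedVectType")]
HB.structure Definition NormedVector (K : numFieldType) :=
  {V of NormedModule K V & Vector K V}.

(* In particular every 'rV[K]_n, n = 0 included, is an instance. *)
HB.instance Definition _ (K : numFieldType) (m n : nat) :=
  Vector.on 'M[K]_(m, n).

Section Topology.
Context {T : topologicalType}.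
Implicit Types (A X : set T) (F : set (set T)).

Definition locally_closed A :=
  exists O C, [/\ open O, closed C & A = O `&` C].

Definition closure_in X A := closure A `&` X.

Definition components A : set (set T) := connected_component A @` A.

(* Local finiteness is only required at the points of X. *)
Definition locally_finite X F :=
  forall x, X x ->
    exists2 U, nbhs x U & finite_set [set A | F A /\ A `&` U !=set0].

End Topology.

Section Submanifolds.
Context {R : realType} {V : normedVectType R}.
Implicit Types (U W M : set V) (f : V -> V).

(* f is of class C^k on the open set U. In finite dimension, asking that all
   directional derivatives be C^k is the same as asking that x |-> 'd f x be. *)
Fixpoint class_C (k : nat) U f : Prop :=
  match k with
  | 0 => forall x, U x -> {for x, continuous f}
  | k'.+1 => (forall x, U x -> differentiable f x) /\
             (forall v, class_C k' U ('D_v f))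
  end.

Definition smooth_on U f := forall k, class_C k U f.

Definition diffeomorphism U W f :=
  [/\ open U, open W, f @` U = W, smooth_on U f &
      exists2 g, smooth_on W g & forall x, U x -> g (f x) = x].

(* Smooth (embedded) submanifolds of V of dimension d, by flattening charts. *)
Definition submanifold (d : nat) M :=
  forall x, M x -> exists U W f (L : {vspace V}),
    [/\ U x, diffeomorphism U W f, \dim L = d &
        f @` (M `&` U) = [set` L] `&` W].

End Submanifolds.

Section Polyhedra.
Context {R : realType} {V : normedVectType R}.
Implicit Types (A P F : set V) (C : set (set V)).

Definition translate (x : V) A : set V := [set x + v | v in A].

(* A zero linear form is allowed; the only sets it adds to the finite
   intersections of genuine half-spaces is the empty set when V = 0. *)
Definition polyhedral_set P :=
  exists m (l : 'I_m -> {scalar V}) (c : 'I_m -> R),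
    P = [set x | forall i, l i x <= c i].

Definition polyhedral_cone P :=
  exists m (l : 'I_m -> {scalar V}), P = [set x | forall i, l i x <= 0].

(* Non-empty faces; l = 0 and c = 0 give P itself. *)
Definition face P F :=
  F !=set0 /\ exists (l : {scalar V}) (c : R),
    (forall x, P x -> l x <= c) /\ F = P `&` [set x | l x = c].

(* The smallest face, which exists for every polyhedral cone. *)
Definition minimal_face P : set V :=
  xget set0 [set F | face P F /\ forall G, face P G -> F `<=` G].

Definition affine_set A :=
  forall x y (t : R), A x -> A y -> A ((1 - t) *: x + t *: y).

Definition affine_hull A : set V := smallest affine_set A.

Definition relative_interior A : set V :=
  [set x | A x /\ exists2 U, nbhs x U & U `&` affine_hull A `<=` A].

Definition polyhedral_complex C :=
  [/\ forall P, C P -> polyhedral_set P /\ P !=set0,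
      forall P F, C P -> face P F -> C F &
      forall P Q, C P -> C Q -> P `&` Q !=set0 ->
        face P (P `&` Q) /\ face Q (P `&` Q)].

Definition fan C :=
  [/\ finite_set C, polyhedral_complex C & forall P, C P -> polyhedral_cone P].

End Polyhedra.

Section Stratifications.
Context {R : realType} {V : normedVectType R}.
Implicit Types (X A : set V) (S : set (set V)).

Definition closed_in_convex X :=
  exists C : set V, [/\ convex_set (C : set (convex_lmodType V)), X `<=` C &
    closed (X : set (subspace C))].

(* The dimension of a non-empty submanifold is unique, so that d and d' below
   are the dimensions of A and B. *)
Definition stratification X S :=
  [/\ partition S id X,
      locally_finite X S,
      forall A, S A ->
        [/\ connected A, locally_closed A & exists d, submanifold d A] &
      forall A B, S A -> S B -> A <> B -> A `&` closure_in X B !=set0 ->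
        A `<=` closure_in X B /\
        exists d d', [/\ submanifold d A, submanifold d' B & (d < d')%N]].

Definition locally_modelled_on_fans X S :=
  forall x0, X x0 -> exists (F : set (set V)) (U : set V),
    [/\ fan F, open U, U x0 &
        \bigcup_(A in S) components (A `&` U) =
        [set translate x0 (relative_interior s) `&` U | s in F]].

Definition fan_stratifications X : set (set (set V)) :=
  [set S | stratification X S /\ locally_modelled_on_fans X S].

End Stratifications.

Section LocallyPolyhedral.
Context {R : realType} {V : normedVectType R}.
Implicit Types (X P A s : set V) (C : set (set V)).

Definition is_local_cone P (x : V) s :=
  polyhedral_cone s /\
  exists U, [/\ open U, U x & P `&` U = translate x s `&` U].

Definition locally_polyhedral P :=
  forall x, P x -> exists s, is_local_cone P x s.

Definition local_cone P (x : V) : set V := xget set0 (is_local_cone P x).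

Definition local_face P (x : V) : set V := minimal_face (local_cone P x).

Definition strata P : set (set V) :=
  \bigcup_(x in P) components [set y | P y /\ local_face P x = local_face P y].

Definition chamber_decomposition X C :=
  [/\ \bigcup_(P in C) P = X /\ locally_finite X C,
      forall P, C P -> P !=set0 /\ locally_polyhedral P,
      forall P A, C P -> strata P A -> C (closure_in X A) &
      forall P Q, C P -> C Q -> P `&` Q !=set0 ->
        exists A, [/\ strata P A, strata Q A & P `&` Q = closure_in X A]].

Definition chamber_decompositions X : set (set (set V)) :=
  [set C | chamber_decomposition X C].

Definition closures_of_strata X (S : set (set V)) : set (set V) :=
  closure_in X @` S.

Definition strata_of_decomposition C : set (set V) := \bigcup_(P in C) strata P.

End LocallyPolyhedral.

(* Main.v *)
Require Import Defs.
From mathcomp Require Import all_boot all_order all_algebra.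
From mathcomp Require Import all_classical all_reals all_analysis.
From mathcomp Require Import ring lra.

Set Implicit Arguments.
Unset Strict Implicit.
Unset Printing Implicit Defensive.

Import Order.TTheory GRing.Theory Num.Theory.
Import numFieldNormedType.Exports.

Local Open Scope classical_set_scope.
Local Open Scope ring_scope.


(** Both sets are compared with a third one. Call a partition [S] of [X] into
    connected cells conical when every point [x] of [X] is the centre of a ball
    in which the cells are exactly the relatively open cones of a fan with apex
    [x], each cell being at most one of these cones. It turns out that the
    stratifications locally modelled on fans are the conical partitions, and
    that closure and strata exchange conical partitions and chamber
    decompositions.

    Polyhedral cones are handled through [facespan s v], the span of the
    smallest face of [s] that contains [v]: the faces of [s] are the sets
    [s `&` facespan s v], the point [v] is relatively interior to [s] exactly
    when [s `<=` facespan s v], and a set [P] with local cone [s] at [x] has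
    local face [facespan s v] at the points [x + v] near [x].

    A conical partition is a stratification locally modelled on fans
    ([conical_fan_stratification]): near a point of a cell [A], the cell is the
    common lineality space of the cones of the fan, so that [A] is open in an
    affine subspace, and a cell whose closure meets [A] contains [A] in its
    closure because the set of such points of [A] is open and closed in [A].

    Conversely ([fan_stratification_conical]), the danger is that a stratum
    reaches one of its limit points along several cones of the fan, like a ring
    cut open along a segment. This is where [X] has to be closed in a convex
    set, because then each stratum [A] is convex ([flat_convex]). Indeed [A] is
    connected and open in an affine subspace; fix [a] in [A] and consider the
    points [b] such that the segment from [a] to [b] lies in [A]. They form an
    open subset of [A] by compactness of the segment. They also form a closed
    one: a limit of such segments lies in [X], and where it could leave [A], at a
    point [y], the nearby segments run inside a single convex piece of [A],
    which is open in the affine subspace and approaches points of the limit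
    segment on both sides of [y], hence contains [y]. Finally a convex set meets
    a small ball in a connected set, that is in only one cone.

    For a conical partition, the closure of a cell has the closed cones as local
    cones, and its local face at [x] depends only on the cell that contains [x].
    Therefore its strata are the cells that it contains
    ([strata_closure_in]). The intersection of two closures is, near each of its
    points, the closure of a single cell; being convex, hence connected, it is
    the closure of a single cell ([closure_in_meet]).

    In the other direction, the strata of any locally polyhedral set form a
    conical partition of that set, the fan at [x] consisting of the faces of the
    local cone ([strata_conical]). In a chamber decomposition these partitions
    fit together: if a stratum [A] meets the closure of a stratum [B], then the
    closures of [A] and [B] are chambers that meet in the closure of a common
    stratum, which contains [A] ([decomposition_frontier]). The fan at [x]
    consists of the local cones of the chambers through [x]. *)

(** * Continuity of linear maps in finite dimension *)

Section FiniteDimension.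
Context {R : realType} {V : normedVectType R}.

(** All norms are equivalent: the norm of [V] is bounded below on the compact
    unit sphere of the coordinate space. *)
Lemma coord_bounded :
  exists2 M : R, 0 < M &
    forall (v : V) i, `|coord (vbasis {:V}) i v| <= M * `|v|.
Proof.
pose X := vbasis {:V}; pose n := \dim {:V}.
pose g (x : 'rV[R]_n) : V := \sum_(i < n) x ord0 i *: X`_i.
pose row_of (v : V) : 'rV[R]_n := \row_i coord X i v.
have gK v : g (row_of v) = v.
  rewrite [RHS](coord_vbasis (memvf v)); apply: eq_bigr => i _.
  by rewrite mxE.
have g_eq0 x : g x = 0 -> x = 0.
  move=> gx0; apply/rowP => i; rewrite mxE.
  have := coord_sum_free (fun i => x ord0 i) i (basis_free (vbasisP {:V})).
  by rewrite -[\sum_(_ < _) _]/(g x) gx0 linear0 => <-.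
have gZ a x : g (a *: x) = a *: g x.
  by rewrite scaler_sumr; apply: eq_bigr => i _; rewrite mxE scalerA.
have g0 : g 0 = 0 by rewrite -[X in g X](scale0r 0) gZ scale0r.
have coord_le (x : 'rV[R]_n) i : `|x ord0 i| <= `|x|.
  rewrite [leRHS]/Num.norm /= mx_normrE.
  exact: (le_bigmax _ (fun ij => `|x ij.1 ij.2|) (ord0, i)).
pose S := [set x : 'rV[R]_n | `|x| = 1].
have cS : compact S.
  apply: bounded_closed_compact.
    by exists 1; split; [exact: num_real | move=> y y1 x /= ->; exact: ltW].
  apply: (@preimage_closed _ _ _ [set 1 : R]); last exact: closed_eq.
  by move=> x _; exact: norm_continuous.
have [S0|S0] := pselect (S !=set0); last first.
  have x0 (x : 'rV[R]_n) : x = 0.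
    apply: contrapT => /eqP xN0; apply: S0; exists (`|x|^-1 *: x).
    by rewrite /S/= normrZ normfV normr_id mulVf// normr_eq0.
  exists 1 => // v i; rewrite mul1r.
  have -> : v = 0 by rewrite -(gK v) (x0 (row_of v)) g0.
  by rewrite linear0 !normr0.
have cg : continuous g.
  apply: continuous_big => [x|i _ x]; first exact: add_continuous.
  exact: (cvgZr_tmp (a := X`_i) (@coord_continuous R 1 n ord0 i x)).
have [|c /set_mem cS1 cmin] := @compact_EVT_min _ _ (fun x => `|g x|) S S0 cS.
  apply: continuous_subspaceT => x.
  by apply: continuous_comp; [exact: cg | exact: norm_continuous].
have m0 : 0 < `|g c|.
  rewrite normr_gt0; apply/eqP => /g_eq0 c0.
  by move: cS1; rewrite /S/= c0 normr0 => /eqP; rewrite eq_sym oner_eq0.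
exists `|g c|^-1; first by rewrite invr_gt0.
move=> v i; set x := row_of v.
have [x0|xN0] := eqVneq x 0.
  have -> : v = 0 by rewrite -(gK v) -/x x0 g0.
  by rewrite linear0 !normr0 mulr0.
have nx : 0 < `|x| by rewrite normr_gt0.
have := cmin (`|x|^-1 *: x); rewrite inE /S/= normrZ normfV normr_id.
rewrite mulVf ?gt_eqF// => /(_ erefl); rewrite gZ gK normrZ normfV normr_id.
rewrite ler_pdivlMl// mulrC -ler_pdivlMl// => h.
by apply: le_trans h; have := coord_le x i; rewrite mxE.
Qed.

Lemma fin_dim_continuous (W : normedModType R) (f : {linear V -> W}) :
  continuous f.
Proof.
apply: bounded_linear_continuous; apply/linear_boundedP.
have [M M0 coordM] := coord_bounded.
pose X := vbasis {:V}; pose B := \sum_(i < \dim {:V}) `|f X`_i|.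
have fB v : `|f v| <= M * B * `|v|.
  rewrite {1}(coord_vbasis (memvf v)) linear_sum mulrAC mulr_sumr.
  apply: (le_trans (ler_norm_sum _ _ _)); apply: ler_sum => i _.
  by rewrite linearZ normrZ ler_wpM2r.
near=> r => v; apply: (le_trans (fB v)); apply: ler_wpM2r => //.
Unshelve. all: by end_near. Qed.

Lemma vspace_closed (L : {vspace V}) : closed [set v | v \in L].
Proof.
pose f : {linear V -> V} := (\1 - projv L)%VF.
have -> : [set v | v \in L] = f @^-1` [set 0].
  apply/seteqP; split=> v /=; rewrite add_lfunE opp_lfunE id_lfunE.
    by move=> /projv_id ->; rewrite subrr.
  by move=> /eqP; rewrite subr_eq0 => /eqP ->; exact: memv_proj.
apply: preimage_closed; last first.
  exact/accessible_closed_set1/hausdorff_accessible/norm_hausdorff.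
by move=> x _; exact: fin_dim_continuous.
Qed.

End FiniteDimension.

(** * Neighbourhoods, connectedness and convexity *)

Section Scalars.
Context {R : realType} {V : normedVectType R}.

Lemma scalar_ext (x y : V) : (forall f : {scalar V}, f x = f y) -> x = y.
Proof.
move=> xy; rewrite (coord_vbasis (memvf x)) (coord_vbasis (memvf y)).
by apply: eq_bigr => i _; rewrite (xy (coord (vbasis {:V}) i)).
Qed.

End Scalars.

(** Identities between linear combinations are checked on scalar forms, where
    they become ring identities. *)
Ltac scalars := apply: scalar_ext => ?;
  rewrite !(linearD, linearN, linearZ, linear0)/= ?/(_ *: _)/=.
Ltac lmod_ring := scalars; ring.
Ltac lmod_field := scalars; field.

Section Neighbourhoods.
Context {R : realType} {V : normedVectType R}.
Implicit Types (A B : set V) (x u v : V) (r t e : R).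

Lemma near0_normP (P : V -> Prop) :
  (\forall v \near 0, P v) <-> exists2 r, 0 < r & forall v, `|v| < r -> P v.
Proof.
split=> [/nbhs_normP [r r0 rP]|[r r0 rP]].
  by exists r => // v vr; apply: rP; rewrite /= sub0r normrN.
by apply/nbhs_normP; exists r => // v /=; rewrite sub0r normrN; exact: rP.
Qed.

Lemma closure_normP A x :
  closure A x <-> forall r, 0 < r -> exists2 v, `|v| < r & A (x + v).
Proof.
split=> [Ax r r0|Ax B /nbhs0P /near0_normP[r r0 rB]].
  have [|y [Ay]] := Ax (ball_ Num.norm x r).
    by apply/nbhs_normP; exists r.
  by rewrite /= distrC => yr; exists (y - x) => //; rewrite addrC subrK.
by have [v vr Av] := Ax r r0; exists (x + v); split => //; exact: rB.
Qed.

Lemma near0_scale (P : V -> Prop) u : (\forall v \near 0, P v) ->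
  exists2 e, 0 < e & forall t, `|t| <= e -> P (t *: u).
Proof.
move=> /near0_normP[r r0 rP]; have u1 : 0 < `|u| + 1 by rewrite ltr_wpDl.
exists (r / (`|u| + 1)); first by rewrite divr_gt0.
move=> t; rewrite ler_pdivlMr// => te; apply: rP; rewrite normrZ.
have [->|t0] := eqVneq t 0; first by rewrite normr0 mul0r.
by apply: lt_le_trans te; rewrite ltr_pM2l ?normr_gt0// ltrDl.
Qed.

Lemma near0_near (P : V -> Prop) : (\forall v \near 0, P v) ->
  \forall v \near 0, \forall u \near 0, P (v + u).
Proof.
move=> /near0_normP[r r0 rP]; apply/near0_normP; exists (r / 2).
  by rewrite divr_gt0.
move=> v vr; apply/near0_normP; exists (r / 2); first by rewrite divr_gt0.
move=> u ur; apply: rP; apply: (le_lt_trans (ler_normD _ _)).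
by rewrite [r]splitr ltrD.
Qed.

(** Connectedness used as an induction principle, with openness in [A] expressed
    by small displacements. *)
Lemma connected_ind A B : connected A -> B `<=` A -> B !=set0 ->
  (forall x, B x -> \forall v \near 0, A (x + v) -> B (x + v)) ->
  (forall x, A x -> closure B x -> B x) ->
  A `<=` B.
Proof.
move=> cA BA B0 oB clB; suff -> : B = A by [].
apply: cA => //.
  exists [set y | A y -> B y]°; first exact: open_interior.
  apply/seteqP; split=> y; last by move=> [Ay /interior_subset]; exact.
  by move=> By; split; [exact: BA | apply/nbhs0P; exact: oB].
exists (closure B); first exact: closed_closure.
apply/seteqP; split=> y; last by move=> [Ay]; exact: clB.
by move=> By; split; [exact: BA | exact: subset_closure].
Qed.

(** The definition by segments, in the form in which it is used throughout;
    [convex_setP] relates it to the convex sets of [convex_lmodType]. *)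
Definition convex A :=
  forall x y t, A x -> A y -> 0 <= t -> t <= 1 -> A (x + t *: (y - x)).

Lemma convex_setP A : convex_set (A : set (convex_lmodType V)) <-> convex A.
Proof.
split=> [cA x y t Ax Ay t0 t1|cA x y t].
  have := @cA y x (Itv01 t0 t1); rewrite !inE => /(_ Ay Ax).
  by congr A; rewrite /conv/= /unstable.onem; lmod_ring.
move=> /set_mem Ax /set_mem Ay; apply/mem_set.
have := cA y x t%:num Ay Ax (ge0 _) (le1 _).
by move=> /(_ erefl erefl); congr A; rewrite /conv/= /unstable.onem; lmod_ring.
Qed.

Lemma convex_connected A : convex A -> connected A.
Proof.
move=> cA; have [[a Aa]|] := pselect (A !=set0); last first.
  by move=> /set0P/negP; rewrite negbK => /eqP ->; exact: connected0.
pose seg y := (fun t : R => a + t *: (y - a)) @` `[0, 1].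
have -> : A = \bigcup_(y in A) seg y.
  apply/seteqP; split=> [y Ay|z [y Ay [t]]].
    exists y => //; exists 1; first by rewrite /= in_itv/= lexx ler01.
    by rewrite scale1r addrC subrK.
  by rewrite /= in_itv/= => /andP[t0 t1] <-; exact: cA.
apply: bigcup_connected.
  exists a => y Ay; exists 0; first by rewrite /= in_itv/= lexx ler01.
  by rewrite scale0r addr0.
move=> y Ay; apply: connected_continuous_connected.
  exact: segment_connected.
apply: continuous_subspaceT => t; apply: cvgD; first exact: cvg_cst.
by apply: cvgZr_tmp; exact: cvg_id.
Qed.

Lemma convexI A B : convex A -> convex B -> convex (A `&` B).
Proof. by move=> cA cB x y t [??] [??] ? ?; split; [exact: cA|exact: cB]. Qed.

Lemma convex_closure A : convex A -> convex (closure A).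
Proof.
move=> cA x y t /closure_normP Ax /closure_normP Ay t0 t1.
apply/closure_normP => r r0.
have [u ur Au] := Ax r r0; have [v vr Av] := Ay r r0.
exists ((1 - t) *: u + t *: v); last first.
  by have := cA _ _ t Au Av t0 t1; congr A; lmod_ring.
apply: (le_lt_trans (ler_normD _ _)); rewrite !normrZ.
rewrite !ger0_norm ?subr_ge0//.
have [->|tN0] := eqVneq t 0; first by rewrite subr0 mul1r mul0r addr0.
apply: (@lt_le_trans _ _ ((1 - t) * r + t * r)); last by lra.
apply: ler_ltD; first by rewrite ler_wpM2l ?subr_ge0// ltW.
by rewrite ltr_pM2l// lt_def tN0.
Qed.

End Neighbourhoods.

Section Balls.
Context {R : realType} {V : normedVectType R}.
Implicit Types (A : set V) (x y v : V) (r : R).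

Lemma ballDE x r v : ball x r (x + v) = (`|v| < r).
Proof. by rewrite -ball_normE/= opprD addrA subrr sub0r normrN. Qed.

Lemma ball_convex x r : convex (ball x r).
Proof.
move=> y z t; rewrite -ball_normE/= => yr zr t0 t1.
have -> : x - (y + t *: (z - y)) = (1 - t) *: (x - y) + t *: (x - z).
  by lmod_ring.
apply: (le_lt_trans (ler_normD _ _)); rewrite !normrZ !ger0_norm ?subr_ge0//.
have [->|tN0] := eqVneq t 0; first by rewrite subr0 mul1r mul0r addr0.
apply: (@lt_le_trans _ _ ((1 - t) * r + t * r)); last by lra.
apply: ler_ltD; first by rewrite ler_wpM2l ?subr_ge0// ltW.
by rewrite ltr_pM2l// lt_def tN0.
Qed.

Lemma translate_convex x A : convex A -> convex (translate x A).
Proof.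
move=> cA y z t [u Au <-] [v Av <-] t0 t1.
exists (u + t *: (v - u)); first exact: cA.
by lmod_ring.
Qed.

End Balls.

(** * Polyhedral cones and their faces *)

Section PolyhedralCones.
Context {R : realType} {V : normedVectType R}.
Implicit Types (s F A P : set V) (x u v w : V) (r t e : R) (l : {scalar V}).

Lemma sum_scalars n (l : 'I_n -> {scalar V}) (I : pred 'I_n) :
  exists L : {scalar V}, forall x, L x = \sum_(i | I i) l i x.
Proof.
suff: exists L : {scalar V}, forall x, L x = \sum_(i <- enum I) l i x.
  by move=> [L LE]; exists L => x; rewrite LE big_enum.
elim: (enum I) => [|i q [L LE]].
  by exists \0 => x; rewrite big_nil.
by exists (l i \+ L) => x; rewrite big_cons/= LE.
Qed.

Lemma polyhedral_coneI s s' :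
  polyhedral_cone s -> polyhedral_cone s' -> polyhedral_cone (s `&` s').
Proof.
move=> [m [l ->]] [n [k ->]].
exists (m + n)%N, (fun i => match fintype.split i with
                            | inl j => l j | inr j => k j end).
apply/seteqP; split=> x /=.
  by move=> [lx kx] i; case: fintype.split.
move=> lkx; split=> i.
  by have := lkx (unsplit (inl i)); rewrite unsplitK.
by have := lkx (unsplit (inr i)); rewrite unsplitK.
Qed.

Lemma polyhedral_cone_halfspace l : polyhedral_cone [set x | l x <= 0].
Proof.
exists 1%N, (fun=> l); apply/seteqP; split=> x /=; first by [].
by move=> /(_ ord0).
Qed.

Lemma scalar_opp l : exists k : {scalar V}, forall x, k x = - l x.
Proof. by exists (-1 \*: l) => x; rewrite /= scaleN1r. Qed.

Lemma polyhedral_cone_hyperplane l : polyhedral_cone [set x | l x = 0].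
Proof.
have [k kE] := scalar_opp l.
have -> : [set x | l x = 0] = [set x | l x <= 0] `&` [set x | k x <= 0].
  apply/seteqP; split=> x /=; first by rewrite kE => ->; rewrite oppr0.
  by rewrite kE oppr_le0 => -[h1 h2]; apply/eqP; rewrite eq_le h1.
by apply: polyhedral_coneI; exact: polyhedral_cone_halfspace.
Qed.

Section ConvexCone.
Variable s : set V.
Hypothesis hs : polyhedral_cone s.

Lemma cone0 : s 0.
Proof. by case: hs => m [l ->] i; rewrite linear0. Qed.

Lemma coneD u v : s u -> s v -> s (u + v).
Proof.
case: hs => m [l ->] su sv i; rewrite linearD.
by rewrite -[0]addr0 lerD.
Qed.

Lemma coneZ t v : 0 <= t -> s v -> s (t *: v).
Proof. by case: hs => m [l ->] t0 sv i; rewrite linearZ/= mulr_ge0_le0. Qed.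

Lemma cone_convex : convex s.
Proof.
move=> u v t su sv t0 t1.
have -> : u + t *: (v - u) = (1 - t) *: u + t *: v by lmod_ring.
by apply: coneD; apply: coneZ => //; rewrite subr_ge0.
Qed.

Lemma cone_closed : closed s.
Proof.
case: hs => m [l ->].
rewrite (_ : [set _ | _] = \bigcap_(i in setT) (l i @^-1` [set y | y <= 0])).
  apply: closed_bigI => i _; apply: preimage_closed; last exact: closed_le.
  by move=> x _; exact: (@fin_dim_continuous _ V R^o).
by apply/seteqP; split=> x /= h i; [move=> _|]; exact: h.
Qed.

End ConvexCone.

(** For a polyhedral cone, the linear span of its smallest face containing [v]. *)
Definition facespan s v : set V :=
  [set u | exists2 e, 0 < e & s (v + e *: u) /\ s (v - e *: u)].

(** By continuity of the finitely many forms. *)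
Lemma slack_near m (l : 'I_m -> {scalar V}) v : (forall i, l i v <= 0) ->
  \forall z \near (0 : V), forall i, l i v + l i z <= 0 \/ l i v = 0.
Proof.
move=> lv; apply: filter_forall => i.
have [lv0|lvN] := eqVneq (l i v) 0; first by apply: nearW; right.
have lvN0 : l i v < 0 by rewrite lt_neqAle lvN lv.
have := @fin_dim_continuous _ V R^o (l i) 0.
move=> /cvgr_dist_lt => /(_ (- l i v)); rewrite oppr_gt0 => /(_ lvN0).
apply: filterS => z; rewrite linear0 sub0r normrN ltr_norml => /andP[_ h].
by left; lra.
Qed.

Lemma facespanP m (l : 'I_m -> {scalar V}) v : (forall i, l i v <= 0) ->
  facespan [set x | forall i, l i x <= 0] v =
  [set u | forall i, l i v = 0 -> l i u = 0].
Proof.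
move=> lv; apply/seteqP; split=> u /=.
  move=> [e e0 [h1 h2]] i lv0.
  have := h1 i; have := h2 i; rewrite linearB linearD linearZ/= lv0 add0r sub0r.
  rewrite oppr_le0 pmulr_rge0// pmulr_rle0// => a b.
  by apply/eqP; rewrite eq_le a b.
move=> lu.
have := slack_near lv.
move=> /(near0_scale u)[e e0 eP].
exists e => //; split=> i; rewrite ?linearB ?linearD linearZ/=.
  have := eP e; rewrite gtr0_norm// => /(_ (lexx _)) /(_ i).
  by rewrite linearZ/= => -[//|lv0]; rewrite lv0 (lu i lv0) mulr0 addr0.
have := eP (- e); rewrite normrN gtr0_norm// => /(_ (lexx _)) /(_ i).
by rewrite linearZ/= mulNr => -[//|lv0]; rewrite lv0 (lu i lv0) mulr0 subr0.
Qed.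

Lemma facespan_vspace s v : polyhedral_cone s -> s v ->
  exists L : {vspace V}, facespan s v = [set` L].
Proof.
move=> [m [l ->]] /facespanP ->.
exists (\bigcap_(i < m | l i v == 0%R)
          lker (linfun (l i : {linear V -> R^o})))%VS.
apply/seteqP; split=> u /=.
  move=> lu; rewrite memvE; apply/subv_bigcapP => i /eqP lv0.
  by rewrite -memvE memv_ker lfunE/= lu.
rewrite memvE => /subv_bigcapP h i lv0.
by have := h i; rewrite lv0 eqxx -memvE memv_ker lfunE => /(_ erefl)/eqP.
Qed.

Section FaceSpan.
Variable s : set V.
Hypothesis hs : polyhedral_cone s.

Lemma facespan_refl v : s v -> facespan s v v.
Proof.
move=> sv; exists 1; first by [].
rewrite scale1r subrr; split; last exact: cone0.
exact: coneD.
Qed.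

Lemma facespanS u v : s v -> facespan s v u -> facespan s u `<=` facespan s v.
Proof.
move=> sv [e e0 [_ vu]] w [d d0 [wp wm]]; exists (e * d); first exact: mulr_gt0.
have h z : s (u + z) -> s (v + e *: z).
  move=> suz; rewrite (_ : v + _ = (v - e *: u) + e *: (u + z)).
    by apply: coneD => //; apply: coneZ => //; exact: ltW.
  by lmod_ring.
by rewrite -scalerA -scalerN; split; exact: h.
Qed.

Lemma facespanDl u v : s u -> s v -> facespan s u `<=` facespan s (u + v).
Proof.
move=> su sv w [e e0 [wp wm]]; exists e => //; rewrite ![u + v + _]addrAC.
by split; exact: coneD.
Qed.

Lemma facespanZ t v : 0 < t -> s v -> facespan s (t *: v) = facespan s v.
Proof.
move=> t0 sv; apply/seteqP; split.
  apply: facespanS => //; exists t^-1; first by rewrite invr_gt0.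
  rewrite scalerA mulVf ?gt_eqF// scale1r subrr; split; last exact: cone0.
  exact: coneD.
apply: facespanS; first by apply: coneZ => //; exact: ltW.
exists t => //; rewrite subrr -scalerDr; split; last exact: cone0.
by apply: coneZ => //; [exact: ltW | exact: coneD].
Qed.

Lemma facespan_small u v : s v -> facespan s v u ->
  exists2 e, 0 < e & forall t, `|t| <= e -> s (v + t *: u).
Proof.
move=> sv [e e0 [vp vm]]; exists e => // t te.
have [t0|t0] := leP 0 t.
  have h := cone_convex hs sv vp (t := t / e).
  have := h _ _; rewrite (_ : v + _ *: _ = v + t *: u); last first.
    by lmod_field; rewrite gt_eqF.
  apply; first by rewrite divr_ge0// ltW.
  by rewrite ler_pdivrMr// mul1r; rewrite ger0_norm in te.
have h := cone_convex hs sv vm (t := - t / e).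
have := h _ _; rewrite (_ : v + _ *: _ = v + t *: u); last first.
  by lmod_field; rewrite gt_eqF.
apply; first by rewrite divr_ge0 ?oppr_ge0// ltW.
by rewrite ler_pdivrMr// mul1r; rewrite ltr0_norm in te.
Qed.

Lemma facespan0 : facespan s 0 = [set u | s u /\ s (- u)].
Proof.
apply/seteqP; split=> u.
  move=> [e e0]; rewrite add0r sub0r => -[su sNu].
  have e'0 : 0 <= e^-1 by rewrite invr_ge0 ltW.
  have := coneZ hs e'0 su; have := coneZ hs e'0 sNu.
  by rewrite scalerN scalerA mulVf ?gt_eqF// scale1r.
by move=> [su sNu]; exists 1 => //; rewrite scale1r add0r sub0r.
Qed.

Lemma facespan0_sub : facespan s 0 `<=` s.
Proof. by rewrite facespan0 => u []. Qed.

Lemma facespan_min v : s v -> facespan s 0 `<=` facespan s v.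
Proof.
by move=> sv; rewrite -[v]add0r; apply: facespanDl => //; exact: cone0.
Qed.

End FaceSpan.

(** Only the constraints that are tight at [v] matter near [v]. *)
Lemma tangent_cone s v : polyhedral_cone s -> s v ->
  exists s', polyhedral_cone s' /\ \forall u \near 0, s (v + u) <-> s' u.
Proof.
move=> [m [l ->]] lv.
exists [set u | forall i, (if l i v == 0 then l i else \0) u <= 0]; split.
  by exists m, (fun i => if l i v == 0 then l i else \0).
have := slack_near lv.
apply: filterS => u hu; split=> /= h i.
  case: eqP => [lv0|//]; have := h i; by rewrite linearD lv0 add0r.
rewrite linearD; have := h i; have [//|lv0] := hu i.
by rewrite lv0 eqxx add0r.
Qed.

(** [facespan] is a local notion: it only depends on the germ of the cone at the
    point. *)
Lemma facespan_germ s s' v w : polyhedral_cone s -> polyhedral_cone s' ->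
  s v -> (\forall u \near 0, s (v + u) <-> s' (w + u)) ->
  facespan s v `<=` facespan s' w.
Proof.
move=> hs hs' sv ss' u us; have [e e0 eP] := facespan_small hs sv us.
have [d d0 dP] := near0_scale u ss'.
pose c := Num.min e d; have c0 : 0 < c by rewrite lt_min e0 d0.
exists c => //; rewrite -scaleNr.
have ce : `|c| <= e by rewrite gtr0_norm// ge_min lexx.
have cd : `|c| <= d by rewrite gtr0_norm// ge_min lexx orbT.
by split; apply/dP; rewrite ?normrN//; apply: eP; rewrite ?normrN.
Qed.

Lemma facespan_tangent s s' v : polyhedral_cone s -> polyhedral_cone s' ->
  s v -> (\forall u \near 0, s (v + u) <-> s' u) ->
  facespan s' 0 = facespan s v.
Proof.
move=> hs hs' sv ss'; apply/seteqP; split; apply: facespan_germ => //.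
- exact: cone0.
- by apply: filterS ss' => u; rewrite add0r; tauto.
- by apply: filterS ss' => u; rewrite add0r.
Qed.

Lemma cone_germ s s' : polyhedral_cone s -> polyhedral_cone s' ->
  (\forall u \near 0, s u <-> s' u) -> s = s'.
Proof.
suff sub s1 s2 : polyhedral_cone s1 -> polyhedral_cone s2 ->
    (\forall u \near 0, s1 u <-> s2 u) -> s1 `<=` s2.
  move=> hs hs' ss'; apply/seteqP; split; apply: sub => //.
  by apply: filterS ss' => u; tauto.
move=> h1 h2 h u s1u; have [e e0 eP] := near0_scale u h.
have : s2 (e *: u).
  by apply/eP; [rewrite gtr0_norm | apply: coneZ => //; exact: ltW].
move=> /(coneZ h2 (t := e^-1)); rewrite invr_ge0 ltW// => /(_ erefl).
by rewrite scalerA mulVf ?gt_eqF// scale1r.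
Qed.

(** Relatively interior points are recognized without affine hulls: from such a
    point one can move in the direction opposite to any point of the cone. *)
Lemma relative_interiorE s : polyhedral_cone s ->
  relative_interior s = [set v | s v /\ s `<=` facespan s v].
Proof.
move=> hs; apply/seteqP; split=> v /= [sv].
  move=> [U /nbhs0P Uv Us]; split => // w sw.
  have [e e0 eU] := near0_scale w Uv.
  exists e => //; split.
    by apply: coneD => //; apply: coneZ => //; exact: ltW.
  apply: Us; split.
    rewrite -scaleNr; apply: eU; by rewrite normrN gtr0_norm.
  (* the point v - e w lies on the line through w and v / (1 + e) *)
  move=> A [affA sA].
  have e1 : 1 + e != 0 by rewrite gt_eqF// ltr_wpDl.
  have -> : v - e *: w = (1 - (1 + e)) *: w + (1 + e) *: ((1 + e)^-1 *: v).
    by lmod_field.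
  apply: affA; apply: sA => //; apply: coneZ => //.
  by rewrite invr_ge0 addr_ge0// ltW.
move=> sF; split => //.
have [s' [hs' ss']] := tangent_cone hs sv.
have [L LE] := facespan_vspace hs sv.
have sL : affine_hull s `<=` facespan s v.
  move=> w; apply; split; last exact: sF.
  by rewrite LE => x y t /= xL yL; apply: memvD; exact: memvZ.
exists [set y | affine_hull s y -> s y]; last by move=> y [/=].
apply/nbhs0P; apply: filterS (ss') => u /= us' /sL vu; apply/us'.
apply: (facespan0_sub hs'); rewrite (facespan_tangent hs hs' sv ss').
  move: vu (facespan_refl hs sv); rewrite LE/= => vu vv.
  by rewrite -[u](addKr v) addrC memvB.
Qed.

Lemma relative_interior_sub s : relative_interior s `<=` s.
Proof. by move=> v []. Qed.

(** A point of the cone with as few tight constraints as possible is relatively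
    interior, for adding another point of the cone cannot make them fewer. *)
Lemma relative_interior_neq0 s : polyhedral_cone s ->
  relative_interior s !=set0.
Proof.
move=> hs; have [m [l sE]] := hs.
pose tight v := #|[set i | l i v == 0]%SET|.
pose Q n := `[< exists2 v, s v & tight v = n >].
have exQ : exists n, Q n.
  by exists (tight 0); apply/asboolP; exists 0 => //; exact: cone0.
case: (ex_minnP exQ) => n /asboolP[v sv vn] minQ.
exists v; rewrite relative_interiorE//; split => // w sw.
have lv := sv; have lw := sw; rewrite sE in lv lw.
have lN0 i : l i (v + w) = 0 -> l i v = 0 /\ l i w = 0.
  rewrite linearD => /eqP; rewrite naddr_eq0 ?lv ?lw// => /andP[/eqP ? /eqP ?].
  by split.
have sub : [set i | l i (v + w) == 0]%SET \subset [set i | l i v == 0]%SET.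
  by apply/fintype.subsetP => i; rewrite !inE => /eqP/lN0[->].
have : [set i | l i (v + w) == 0]%SET = [set i | l i v == 0]%SET.
  apply/eqP; rewrite eqEcard sub/= -[#|[set i | l i v == 0]%SET|]/(tight v) vn.
  apply: minQ.
  by apply/asboolP; exists (v + w) => //; exact: coneD.
move=> /setP vwE; rewrite sE facespanP// => i /= lv0.
by have := vwE i; rewrite !inE lv0 eqxx => /eqP/lN0[].
Qed.

Lemma relative_interior_ray s u v t : polyhedral_cone s ->
  relative_interior s v -> s u -> 0 < t ->
  relative_interior s (u + t *: v).
Proof.
move=> hs; rewrite relative_interiorE// => -[sv sF] su t0; split.
  by apply: coneD => //; apply: coneZ => //; exact: ltW.
move=> w /sF; rewrite -(facespanZ hs t0 sv) addrC.
by apply: facespanDl => //; apply: coneZ => //; exact: ltW.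
Qed.

Lemma relative_interiorZ s v t : polyhedral_cone s ->
  relative_interior s v -> 0 < t -> relative_interior s (t *: v).
Proof.
move=> hs sv t0; rewrite -[_ *: _]add0r.
by apply: relative_interior_ray => //; exact: cone0.
Qed.

Lemma relative_interior_convex s : polyhedral_cone s ->
  convex (relative_interior s).
Proof.
move=> hs u v t su sv t0 t1.
have [->|tN0] := eqVneq t 0; first by rewrite scale0r addr0.
have -> : u + t *: (v - u) = (1 - t) *: u + t *: v by lmod_ring.
apply: relative_interior_ray => //; last by rewrite lt_def tN0.
by apply: coneZ; rewrite ?subr_ge0//; exact: relative_interior_sub.
Qed.

Lemma relative_interior_face s v : polyhedral_cone s -> s v ->
  polyhedral_cone (s `&` facespan s v) ->
  relative_interior (s `&` facespan s v) =
  [set w | s w /\ facespan s w = facespan s v].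
Proof.
move=> hs sv hF; rewrite relative_interiorE//; apply/seteqP; split=> w /=.
  move=> [[sw vw] Fw]; split => //; apply/seteqP; split; first exact: facespanS.
  apply: facespanS => //.
  have /Fw[e e0 [[sp _] [sm _]]] : (s `&` facespan s v) v.
    by split => //; exact: facespan_refl.
  by exists e.
move=> [sw wv]; rewrite -wv.
have [L LE] := facespan_vspace hs sw.
have ww := facespan_refl hs sw.
split; first by split.
move=> u [su [e e0 [up um]]]; exists e => //; rewrite LE in ww *.
have uL : u \in L by have : facespan s w u by [exists e]; rewrite LE.
by split; (split; first by []); [apply: memvD | apply: memvB] => //; exact: memvZ.
Qed.

(** The constant in the definition of a face must vanish, since it bounds the
    form both at [0] and at the double of a point of the face. *)
Lemma face_linear s F : polyhedral_cone s -> face s F ->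
  exists l, (forall x, s x -> l x <= 0) /\ F = s `&` [set x | l x = 0].
Proof.
move=> hs [[x0 Fx0] [l [c [lc FE]]]]; exists l.
suff -> : 0 = c by [].
move: Fx0; rewrite FE => -[sx0 lx0]; apply/eqP; rewrite eq_le.
have -> /= : 0 <= c by rewrite -(linear0 l) lc//; exact: cone0.
by have := lc _ (coneD hs sx0 sx0); rewrite linearD lx0 gerDl.
Qed.

Lemma facespan_scalar0 l s u v : (forall x, s x -> l x <= 0) -> l v = 0 ->
  facespan s v u -> l u = 0.
Proof.
move=> ls lv [e e0 [/ls + /ls]]; rewrite linearB linearD linearZ/= lv.
rewrite add0r sub0r oppr_le0 pmulr_rge0// pmulr_rle0// => a b.
by apply/eqP; rewrite eq_le a b.
Qed.

Lemma face_cone s F : polyhedral_cone s -> face s F -> polyhedral_cone F.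
Proof.
move=> hs /(face_linear hs)[l [_ ->]]; apply: polyhedral_coneI => //.
exact: polyhedral_cone_hyperplane.
Qed.

Lemma face_facespan s F v : polyhedral_cone s -> face s F ->
  relative_interior F v -> F = s `&` facespan s v.
Proof.
move=> hs sF; have hF := face_cone hs sF.
have [l [ls FE]] := face_linear hs sF.
rewrite relative_interiorE// => -[Fv Fsub].
have Fs : F `<=` s by rewrite FE => x [].
apply/seteqP; split=> w.
  move=> Fw; split; first exact: Fs.
  by have [e e0 [/Fs h1 /Fs h2]] := Fsub w Fw; exists e.
move=> [sw vw]; rewrite FE; split => //=; apply: facespan_scalar0 ls _ vw.
by move: Fv; rewrite FE => -[].
Qed.

(** The sum of the constraints that are tight at [v] cuts out the smallest face
    that contains [v]. *)
Lemma facespan_face s v : polyhedral_cone s -> s v ->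
  face s (s `&` facespan s v).
Proof.
move=> hs sv; split; first by exists v; split => //; exact: facespan_refl.
have [m [l sE]] := hs.
have [L LE] := sum_scalars l (fun i => l i v == 0).
exists L, 0; split=> [x|].
  by rewrite sE LE => lx; apply: sumr_le0 => i _.
rewrite sE; apply/seteqP; split=> x /= [lx];
  rewrite facespanP; try by rewrite sE in sv.
  by move=> h; split => //; rewrite LE; apply: big1 => i /eqP/h.
rewrite LE => /eqP; rewrite -oppr_eq0 -sumrN psumr_eq0; last first.
  by move=> i _; rewrite oppr_ge0.
move=> /allP h; split => // i lv0; have := h i (mem_index_enum _).
by rewrite lv0 eqxx oppr_eq0 => /eqP.
Qed.

Lemma faceP s F : polyhedral_cone s ->
  face s F <-> exists2 v, s v & F = s `&` facespan s v.
Proof.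
move=> hs; split=> [sF|[v sv ->]]; last exact: facespan_face.
have [v Fv] := relative_interior_neq0 (face_cone hs sF).
have FE := face_facespan hs sF Fv; exists v => //.
by have := relative_interior_sub Fv; rewrite FE => -[].
Qed.

Lemma face_trans s F G : polyhedral_cone s -> face s F -> face F G -> face s G.
Proof.
move=> hs sF FG; have hF := face_cone hs sF.
have [v Gv] := relative_interior_neq0 (face_cone hF FG).
have GE := face_facespan hF FG Gv.
have Fv : F v by have := relative_interior_sub Gv; rewrite GE => -[].
have [l [ls FE]] := face_linear hs sF.
have Fs : F `<=` s by rewrite FE => x [].
have sv := Fs _ Fv.
suff -> : G = s `&` facespan s v by exact: facespan_face.
rewrite GE; apply/seteqP; split=> w [].
  by move=> Fw [e e0 [/Fs h1 /Fs h2]]; split; [exact: Fs|exists e].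
move=> sw vw; suff FF u : facespan s v u -> s u -> F u.
  have [L LE] := facespan_vspace hs sv; have vv := facespan_refl hs sv.
  have [e e0 [vp vm]] := vw; split; first exact: FF.
  exists e => //; rewrite LE/= in vv vw FF.
  by split; apply: FF => //=; [apply: memvD | apply: memvB] => //; exact: memvZ.
move=> vu su; rewrite FE; split => //=; apply: facespan_scalar0 ls _ vu.
by move: Fv; rewrite FE => -[].
Qed.

(** A face is determined by the constraints that are tight on it. *)
Lemma faces_finite s : polyhedral_cone s -> finite_set (face s).
Proof.
move=> hs; have [m [l sE]] := hs.
pose F (I : {set 'I_m}) := s `&` [set u | forall i, i \in I -> l i u = 0].
apply: (@sub_finite_set _ _ (range F)); last exact: finite_image.
move=> G /(faceP _ hs)[v sv ->]; exists [set i | l i v == 0]%SET => //.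
rewrite /F sE facespanP; last by rewrite sE in sv.
congr (_ `&` _); apply/seteqP; split=> u h i.
  by move=> lv0; apply: h; rewrite inE lv0.
by rewrite inE => /eqP; exact: h.
Qed.

Lemma minimal_faceE s : polyhedral_cone s -> minimal_face s = facespan s 0.
Proof.
move=> hs; have s0 := cone0 hs.
have faceM : face s (facespan s 0).
  by have := facespan_face hs s0; rewrite setIidr//; exact: facespan0_sub.
have leM G : face s G -> facespan s 0 `<=` G.
  move=> /(faceP _ hs)[v sv ->] u u0.
  by split; [exact: facespan0_sub|exact: facespan_min u0].
rewrite /minimal_face; case: xgetP => [M _ [sM Mle]|/(_ (facespan s 0))[]//].
by apply/seteqP; split; [exact: Mle | exact: leM].
Qed.

End PolyhedralCones.

(** * Local cones and fans *)

Section LocalCones.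
Context {R : realType} {V : normedVectType R}.
Implicit Types (s F A P : set V) (x u v w : V) (r t e : R).

Lemma translateE x A v : translate x A (x + v) <-> A v.
Proof. by split=> [[u Au /addrI <-]|Av]; last exists v. Qed.

Lemma is_local_coneP P x s :
  is_local_cone P x s <->
  polyhedral_cone s /\ \forall v \near 0, P (x + v) <-> s v.
Proof.
split=> -[hs].
  move=> [U [oU Ux PU]]; split => //.
  have /nbhs0P : nbhs x U by exact: open_nbhs_nbhs.
  apply: filterS => v Uv; split=> [Pv|sv].
    by apply/(translateE x); have : (P `&` U) (x + v) by []; rewrite PU => -[].
  have : (translate x s `&` U) (x + v) by split => //; exact/translateE.
  by rewrite -PU => -[].
move=> /near0_normP[r r0 Pr]; split => //.
exists (ball x r); split; [exact: ball_open | exact: ballxx |].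
apply/seteqP; split=> y; rewrite -[y](subrK x) addrC => -[yP];
  rewrite ballDE => yr; split; rewrite ?ballDE//.
  by apply/translateE/(Pr _ yr).
by apply/(Pr _ yr)/(translateE x).
Qed.

Lemma local_coneE P x s : is_local_cone P x s -> local_cone P x = s.
Proof.
move=> hPs; rewrite /local_cone; case: xgetP => [s' _|/(_ s)//].
move: hPs => /is_local_coneP[hs Ps] /is_local_coneP[hs' Ps'].
by apply: cone_germ => //; near=> v; rewrite -(near Ps v)// -(near Ps' v).
Unshelve. all: by end_near. Qed.

Lemma local_faceE P x s : is_local_cone P x s -> local_face P x = facespan s 0.
Proof.
move=> hPs; rewrite /local_face (local_coneE hPs) minimal_faceE//.
by case: hPs.
Qed.

(** The local cone [s] of [P] at [x] also determines the local cones of [P] at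
    the points [x + v] near [x]: they are the tangent cones of [s] at [v]. *)
Lemma local_face_near P x s : is_local_cone P x s ->
  \forall v \near 0, (P (x + v) <-> s v) /\
    (s v -> local_face P (x + v) = facespan s v).
Proof.
move=> /is_local_coneP[hs Ps].
near=> v; have Pv : P (x + v) <-> s v by near: v.
have Pvu : \forall u \near 0, P (x + (v + u)) <-> s (v + u).
  by near: v; exact: near0_near Ps.
suff : s v -> local_face P (x + v) = facespan s v by tauto.
move=> sv; have [s' [hs' ss']] := tangent_cone hs sv.
rewrite (@local_faceE P (x + v) s') ?(facespan_tangent hs hs' sv ss')//.
apply/is_local_coneP; split => //; near=> u; rewrite -addrA.
by rewrite (near Pvu u)// (near ss' u).
Unshelve. all: by end_near. Qed.

End LocalCones.

Section Fans.
Context {R : realType} {V : normedVectType R}.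
Implicit Types (s : set V) (v w : V) (F : set (set V)).

Lemma polyhedral_cone_set s : polyhedral_cone s -> polyhedral_set s.
Proof. by move=> [m [l ->]]; exists m, l, (fun=> 0). Qed.

Lemma faces_fan s : polyhedral_cone s -> fan (face s).
Proof.
move=> hs; have F0 f : face s f -> f 0 by move=> /face_cone/cone0; exact.
have faceI f g : face s f -> face s g -> face f (f `&` g).
  move=> sf sg; have [l [ls ->]] := face_linear hs sg.
  have fs : f `<=` s by have [k [ks ->]] := face_linear hs sf; move=> x [].
  split.
    exists 0; split; first exact: F0.
    by split; rewrite /= ?linear0//; exact: cone0.
  exists l, 0; split; first by move=> x /fs/ls.
  apply/seteqP; split=> x /= [fx].
    by move=> [_ lx].
  by move=> lx; split => //; split => //; exact: fs.
split; [exact: faces_finite | split | by move=> f; exact: face_cone].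
- move=> f sf; split; last by exists 0; exact: F0.
  exact: polyhedral_cone_set (face_cone hs sf).
- by move=> f g sf fg; exact: face_trans fg.
- by move=> f g sf sg _; split; [|rewrite setIC]; exact: faceI.
Qed.

Section Fan.
Variable F : set (set V).
Hypothesis fanF : fan F.

Lemma fan_cone s : F s -> polyhedral_cone s.
Proof. by case: fanF => _ _; exact. Qed.

Lemma fanI s s' : F s -> F s' -> face s (s `&` s').
Proof.
move=> Fs Fs'; have [_ [_ _ h] _] := fanF.
have [] // := h s s' Fs Fs'; exists 0.
by split; apply: cone0; exact: fan_cone.
Qed.

Lemma fan_face s f : F s -> face s f -> F f.
Proof. by move=> Fs; case: fanF => _ [_ h _] _; exact: h. Qed.

(** Two cones of a fan meet in a common face, and a face that contains a
    relatively interior point of a cone is the whole cone. *)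
Lemma fan_interior_inj s s' v : F s -> F s' ->
  relative_interior s v -> relative_interior s' v -> s = s'.
Proof.
suff sub s1 s2 : F s1 -> F s2 ->
    relative_interior s1 v -> s2 v -> s1 `<=` s2.
  move=> Fs Fs' sv s'v; apply/seteqP.
  by split; apply: sub => //; exact: relative_interior_sub.
move=> F1 F2; have h1 := fan_cone F1.
rewrite relative_interiorE// => -[s1v s1F] s2v u s1u.
have [l [ls FE]] := face_linear h1 (fanI F1 F2).
have : (s1 `&` s2) v by []; rewrite FE => -[_ /= lv].
have lu := facespan_scalar0 ls lv (s1F _ s1u).
by have : (s1 `&` [set x | l x = 0]) u by []; rewrite -FE => -[].
Qed.

Lemma fan_carrier s v : F s -> s v ->
  F (s `&` facespan s v) /\ relative_interior (s `&` facespan s v) v.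
Proof.
move=> Fs sv; have hs := fan_cone Fs; have sf := facespan_face hs sv.
split; first exact: fan_face sf.
by rewrite relative_interior_face//; exact: face_cone sf.
Qed.

End Fan.

Lemma relative_interior_lineality s : polyhedral_cone s ->
  relative_interior (facespan s 0) = facespan s 0.
Proof.
move=> hs; have s0 := cone0 hs.
have sE : s `&` facespan s 0 = facespan s 0.
  by apply: setIidr; exact: facespan0_sub.
rewrite -{1}sE.
rewrite (relative_interior_face hs s0 (face_cone hs (facespan_face hs s0))).
apply/seteqP; split=> w /=.
  by move=> [sw <-]; exact: facespan_refl.
move=> w0; split; first exact: facespan0_sub.
apply/seteqP; split; first exact: facespanS.
by apply: facespan_min => //; exact: (facespan0_sub hs).
Qed.

(** All the cones of a fan have the same lineality space, the only cone of the
    fan that contains [0] in its relative interior. *)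
Lemma fan_lineality F s s' : fan F -> F s -> F s' ->
  relative_interior s 0 -> s = facespan s' 0.
Proof.
move=> fanF Fs Fs' s0; have hs' := fan_cone fanF Fs'.
have [F0 i0] := fan_carrier fanF Fs' (cone0 hs').
rewrite (fan_interior_inj fanF Fs F0 s0 i0).
by apply: setIidr; exact: facespan0_sub.
Qed.

End Fans.

(** * Charts by fans *)

Section Charts.
Context {R : realType} {V : normedVectType R}.
Implicit Types (X A B s : set V) (x u v w : V) (r t e : R).
Implicit Types (S F : set (set V)) (L : {vspace V}).

Definition models A x r s :=
  forall v, `|v| < r -> A (x + v) <-> relative_interior s v.

(** One radius serves all the members of [S], so that a chart describes the whole
    of [S] near [x]. *)
Definition chart S x F r :=
  [/\ 0 < r, fan F,
      forall A v, S A -> `|v| < r -> A (x + v) ->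
        exists2 s, F s & models A x r s &
      forall s, F s -> exists2 A, S A & models A x r s].

Definition conical_partition X S :=
  [/\ partition S id X, forall A, S A -> connected A &
      forall x, X x -> exists F r, chart S x F r].

Lemma models_le A x r r' s : r' <= r -> models A x r s -> models A x r' s.
Proof. by move=> r'r As v vr; apply: As; exact: lt_le_trans r'r. Qed.

Lemma chart_le S x F r r' : 0 < r' -> r' <= r -> chart S x F r ->
  chart S x F r'.
Proof.
move=> r'0 r'r [r0 fanF SF FS]; split => // [A v SA vr Av|s Fs].
  have [s Fs As] := SF A v SA (lt_le_trans vr r'r) Av.
  by exists s => //; exact: models_le As.
by have [A SA As] := FS s Fs; exists A => //; exact: models_le As.
Qed.

Lemma models_closure A x r s : polyhedral_cone s -> models A x r s ->
  forall v, `|v| < r -> closure A (x + v) <-> s v.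
Proof.
move=> hs As v vr; split=> [/closure_normP Av|sv].
  have := cone_closed hs; rewrite closure_id => ->.
  apply/closure_normP => e e0.
  have d0 : 0 < Num.min e (r - `|v|) by rewrite lt_min e0 subr_gt0.
  have [u] := Av _ d0; rewrite lt_min => /andP[ue ur] Au; exists u => //.
  apply: relative_interior_sub; apply/As; last by rewrite addrA.
  by apply: (le_lt_trans (ler_normD _ _)); rewrite -ltrBrDl.
have [w sw] := relative_interior_neq0 hs; apply/closure_normP => e e0.
have d0 : 0 < Num.min e (r - `|v|) by rewrite lt_min e0 subr_gt0.
have : \forall u \near (0 : V), `|u| < Num.min e (r - `|v|).
  by apply/near0_normP; exists (Num.min e (r - `|v|)).
move=> /(near0_scale w)[c c0 /(_ c)].
rewrite gtr0_norm// lexx lt_min => /(_ erefl)/andP[ce cr].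
exists (c *: w) => //; rewrite -addrA; apply/As.
  by apply: (le_lt_trans (ler_normD _ _)); rewrite -ltrBrDl.
exact: relative_interior_ray.
Qed.

Lemma models_center A x r s : polyhedral_cone s -> 0 < r -> models A x r s ->
  closure A x.
Proof.
move=> hs r0 As; rewrite -[x]addr0; apply/(models_closure hs As).
  by rewrite normr0.
exact: cone0.
Qed.

Lemma models_neq0 A x r s : polyhedral_cone s -> 0 < r -> models A x r s ->
  exists v, [/\ `|v| < r, relative_interior s v & A (x + v)].
Proof.
move=> hs r0 As.
have /closure_normP/(_ r r0)[v vr Av] := models_center hs r0 As.
by exists v; split => //; exact/As.
Qed.

Section Chart.
Variables (S F : set (set V)) (x : V) (r : R).
Hypothesis chF : chart S x F r.

Lemma chart_gt0 : 0 < r. Proof. by case: chF. Qed.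
Lemma chart_fan : fan F. Proof. by case: chF. Qed.

Lemma chart_cone s : F s -> polyhedral_cone s.
Proof. exact: fan_cone chart_fan _. Qed.

Lemma chart_sub A : S A -> closure A x -> exists2 s, F s & models A x r s.
Proof.
have [r0 _ SF _] := chF; move=> SA /closure_normP/(_ r r0)[v vr Av].
exact: SF Av.
Qed.

(** The cone modelling the member [A] that contains the centre has [0] in its
    relative interior, so it is the lineality space of the fan. *)
Lemma chart_stratum A s : S A -> A x -> F s -> models A x r (facespan s 0).
Proof.
move=> SA Ax Fs; have [s' Fs' As'] := chart_sub SA (subset_closure Ax).
rewrite -(fan_lineality chart_fan Fs' Fs)//.
by apply/As'; rewrite ?addr0// normr0 chart_gt0.
Qed.

Lemma chart_stratumE A s v : S A -> A x -> F s -> `|v| < r ->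
  A (x + v) <-> facespan s 0 v.
Proof.
move=> SA Ax Fs vr; rewrite (chart_stratum SA Ax Fs vr).
by rewrite relative_interior_lineality//; exact: chart_cone.
Qed.

End Chart.

Definition flat L A :=
  forall x, A x -> \forall v \near 0, A (x + v) <-> v \in L.

Lemma vspace_germ L L' : (\forall v \near (0 : V), (v \in L) = (v \in L')) ->
  L = L'.
Proof.
suff sub L1 L2 : (\forall v \near (0 : V), (v \in L1) = (v \in L2)) ->
    (L1 <= L2)%VS.
  move=> LL'; apply/eqP; rewrite eqEsubv !sub//.
  by apply: filterS LL' => v ->.
move=> h; apply/subvP => v vL; have [e e0 /(_ e)] := near0_scale v h.
rewrite gtr0_norm// lexx => /(_ erefl); rewrite memvZ// => /esym.
move=> /(memvZ e^-1); by rewrite scalerA mulVf ?gt_eqF// scale1r.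
Qed.

(** The direction is locally constant, because affine subspaces that agree near a
    point have the same direction. *)
Lemma connected_flat A : connected A ->
  (forall x, A x -> exists L, \forall v \near 0, A (x + v) <-> v \in L) ->
  exists L, flat L A.
Proof.
move=> cA locA; have [[a Aa]|A0] := pselect (A !=set0); last first.
  by exists 0%VS => x Ax; case: A0; exists x.
have [L aL] := locA a Aa; exists L.
pose near_flat L x := \forall v \near 0, A (x + v) <-> v \in L.
have moveL M x : near_flat M x ->
    \forall v \near 0, A (x + v) -> near_flat M (x + v).
  move=> xM; near=> v => Av; have vM : v \in M by apply/(near xM v).
  have : \forall u \near 0, A (x + (v + u)) <-> v + u \in M.
    by near: v; exact: near0_near xM.
  by apply: filterS => u; rewrite addrA (rpredDl u vM).
suff : A `<=` A `&` near_flat L by move=> h x /h[].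
apply: connected_ind => //; first by exists a.
  move=> x [_ /moveL]; apply: filterS => v h Av; split => //; exact: h.
move=> x Ax /closure_normP clx; split => //.
have [M xM] := locA x Ax; have /near0_normP[e e0 Me] := moveL _ _ xM.
have [v ve [Av LxL]] := clx e e0; have MxM := Me v ve Av.
rewrite (_ : L = M)//; apply: vspace_germ; apply: filterS2 MxM LxL => u h1 h2.
by apply/idP/idP => h; [apply/h1/h2 | apply/h2/h1].
Unshelve. all: by end_near. Qed.

End Charts.

(** * Open subsets of affine subspaces *)

Section TranslationSmooth.
Context {R : realType} {V : normedVectType R}.

Lemma class_C_cst k (U : set V) (c : V) : class_C k U (fun=> c).
Proof.
elim: k c => [|k IH] c /=; first by move=> x _; exact: cst_continuous.
split=> [x _|v]; first exact: differentiable_cst.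
rewrite (_ : 'D_v _ = fun=> 0); first exact: IH.
by apply/funext => x; exact: derive_cst.
Qed.

Lemma translation_smooth (U : set V) (c : V) : smooth_on U (fun y => y + c).
Proof.
have difft y : differentiable (fun y : V => y + c) y.
  by apply: differentiableD => //; exact: differentiable_cst.
case=> [|k] /=; first by move=> x _; exact: differentiable_continuous.
split=> [x _|v]; first exact: difft.
rewrite (_ : 'D_v _ = fun=> v); first exact: class_C_cst.
apply/funext => x; rewrite deriveD; [|exact: derivable_id|exact: derivable_cst].
by rewrite derive_id derive_cst addr0.
Qed.

End TranslationSmooth.

Section FlatSets.
Context {R : realType} {V : normedVectType R}.
Implicit Types (A : set V) (x y v : V) (L : {vspace V}).

Lemma flat_sub L A x y : connected A -> flat L A -> A x -> A y -> y - x \in L.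
Proof.
move=> cA fA Ax; suff : A `<=` A `&` [set z | z - x \in L].
  by move=> h /h[].
apply: connected_ind => //.
  by exists x; split => //=; rewrite subrr mem0v.
  move=> z [Az /= zL]; apply: filterS (fA z Az) => v zv Azv; split => //=.
  by rewrite addrAC memvD//; exact/zv.
move=> z Az /closure_normP clz; split => //=.
have /near0_normP[e e0 Ae] := fA z Az.
have [v ve [Azv /= vL]] := clz e e0.
have {}ve : v \in L by apply/(Ae v ve).
by have -> : z - x = (z + v - x) - v; [lmod_ring | exact: memvB].
Qed.

Lemma flat_locally_closed L A : connected A -> flat L A -> locally_closed A.
Proof.
move=> cA fA; have [[a Aa]|] := pselect (A !=set0); last first.
  move=> /set0P/negP; rewrite negbK => /eqP ->; exists set0, set0.
  by split; [exact: open0 | exact: closed0 | rewrite setI0].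
pose C := [set y | y - a \in L].
exists [set y | C y -> A y]°, C; split; first exact: open_interior.
  apply: (@preimage_closed _ _ (fun y => y - a) [set v | v \in L]).
    by move=> y _; apply: cvgB; [exact: cvg_id | exact: cvg_cst].
  exact: vspace_closed.
apply/seteqP; split=> [y Ay|y [/interior_subset]]; last exact.
have ya : C y by exact: flat_sub Aa Ay.
split => //; apply/nbhs0P; apply: filterS (fA y Ay) => v Ayv.
rewrite /C/= => yvL.
by apply/Ayv; have -> : v = (y + v - a) - (y - a); [lmod_ring | exact: memvB].
Qed.

(** Translations serve as flattening charts. *)
Lemma flat_submanifold L A : flat L A -> submanifold (\dim L) A.
Proof.
move=> fA x Ax; have /near0_normP[r r0 Ar] := fA x Ax.
have ballE y : ball x r y = (`|y - x| < r).
  by rewrite -[y in LHS](subrK x) addrC ballDE.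
have ball0E y : ball (0 : V) r y = (`|y| < r).
  by rewrite -[y in LHS]add0r ballDE.
exists (ball x r), (ball 0 r), (fun y => y - x), L; split => //.
- exact: ballxx.
- split; [exact: ball_open | exact: ball_open | | exact: translation_smooth|].
    apply/seteqP; split=> [_ [y + <-]|y]; rewrite ball0E ?ballE// => yr.
    by exists (y + x); rewrite ?ballE addrK.
  exists (fun y => y + x); first exact: translation_smooth.
  by move=> y _; rewrite subrK.
apply/seteqP; split=> [_ [y [Ay +] <-]|y [/= yL]].
  rewrite ballE => yr; split; last by rewrite ball0E.
  by apply/Ar => //; rewrite addrC subrK.
rewrite ball0E => yr; exists (y + x); last by rewrite addrK.
by rewrite /= ballE addrK; split => //; rewrite addrC; exact/Ar.
Qed.

End FlatSets.

(** * Conical partitions are stratifications locally modelled on fans *)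

Section ConicalPartitions.
Context {R : realType} {V : normedVectType R}.
Implicit Types (A B s : set V) (x u v w : V) (r t e : R).
Implicit Types (F : set (set V)) (L : {vspace V}).

Lemma models_ball A x r s : models A x r s ->
  A `&` ball x r = translate x (relative_interior s) `&` ball x r.
Proof.
move=> As; apply/seteqP; split=> y; rewrite -[y](subrK x) addrC => -[yA];
  rewrite ballDE => yr; split; rewrite ?ballDE//; first by apply/translateE/As.
by apply/As => //; apply/(translateE x).
Qed.

Lemma models_convex A x r s : polyhedral_cone s -> models A x r s ->
  convex (A `&` ball x r).
Proof.
move=> hs /models_ball ->; apply: convexI; last exact: ball_convex.
by apply: translate_convex; exact: relative_interior_convex.
Qed.

Section Conical.
Variables (X : set V) (S : set (set V)).
Hypothesis hS : conical_partition X S.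

Lemma cell_sub A : S A -> A `<=` X.
Proof. by case: hS => -[<- _ _] _ _ SA x Ax; exists A. Qed.

Lemma cell_ex x : X x -> exists2 A, S A & A x.
Proof. by case: hS => -[<- _ _] _ _ [A SA Ax]; exists A. Qed.

Lemma cell_neq0 A : S A -> A !=set0.
Proof. by case: hS => -[_ _ +] _ _; exact. Qed.

Lemma cell_inj A B x : S A -> S B -> A x -> B x -> A = B.
Proof. by case: hS => -[_ tS _] _ _ SA SB Ax Bx; apply: tS => //; exists x. Qed.

Lemma cell_connected A : S A -> connected A.
Proof. by case: hS => _ + _; exact. Qed.

Lemma conical_chart x : X x -> exists F r, chart S x F r.
Proof. by case: hS => _ _; exact. Qed.

Lemma cell_flat A : S A -> exists L, flat L A.
Proof.
move=> SA; apply: connected_flat; first exact: cell_connected.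
move=> x Ax; have [F [r ch]] := conical_chart (cell_sub SA Ax).
have [s Fs _] := chart_sub ch SA (subset_closure Ax).
have hs := chart_cone ch Fs.
have [L LE] := facespan_vspace hs (cone0 hs); exists L.
apply/near0_normP; exists r; first exact: chart_gt0 ch.
by move=> v vr; rewrite (chart_stratumE ch SA Ax Fs vr) LE.
Qed.

(** Near a common point [x] the closure of [B] is modelled on a cone of the fan
    and [A] on the lineality space of that cone, so that the points of [A] in
    the closure of [B] form an open and closed subset of [A]. *)
Lemma cell_frontier A B x : S A -> S B -> A x -> closure B x ->
  A `<=` closure B.
Proof.
move=> SA SB Ax Bx; suff : A `<=` A `&` closure B by move=> h y /h[].
apply: connected_ind; [exact: cell_connected | by [] | by exists x | | ].
  move=> y [Ay By]; have [F [r ch]] := conical_chart (cell_sub SA Ay).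
  have [s Fs Bs] := chart_sub ch SB By; have hs := chart_cone ch Fs.
  apply/near0_normP; exists r; first exact: chart_gt0 ch.
  move=> v vr Av; split => //; apply/(models_closure hs Bs) => //.
  by apply: (facespan0_sub hs); rewrite -(chart_stratumE ch SA Ay Fs vr).
move=> y Ay clAB; split => //.
have /closure_id -> := @closed_closure _ B.
by apply: closureS clAB => z [].
Qed.

(** In a chart distinct cells have distinct cones, and a fan is finite. *)
Lemma conical_locally_finite : locally_finite X S.
Proof.
move=> x Xx; have [F [r ch]] := conical_chart Xx; have [r0 fanF SF FS] := ch.
exists (ball x r); first exact: nbhsx_ballx.
have [finF _ _] := fanF.
pose cell s := xget set0 [set A | S A /\ models A x r s].
apply: (@sub_finite_set _ _ (cell @` F)); last exact: finite_image.
move=> A /= [SA [y [Ay]]]; rewrite -[y](subrK x) addrC ballDE => yr.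
have [|s Fs As] := SF A (y - x) SA yr.
  by move: Ay; rewrite [x + _]addrC subrK.
exists s => //; rewrite /cell; case: xgetP => [B _ [SB Bs]|/(_ A)[]//].
have [v [vr sv Av]] := models_neq0 (chart_cone ch Fs) r0 As.
by apply: (cell_inj SB SA (x := x + v)) => //; apply/Bs.
Qed.

(** At the common point [x] the cell [B] is modelled on a cone [s] and [A] on
    the lineality space of [s]. The former spans [L'] and the latter is [L], and
    they differ because the cells do. *)
Lemma cell_dim A B x L L' : S A -> S B -> A <> B -> A x -> closure B x ->
  flat L A -> flat L' B -> (\dim L < \dim L')%N.
Proof.
move=> SA SB AB Ax Bx fA fB; have [F [r ch]] := conical_chart (cell_sub SA Ax).
have [s Fs Bs] := chart_sub ch SB Bx; have hs := chart_cone ch Fs.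
have r0 := chart_gt0 ch.
have [v [vr sv Bv]] := models_neq0 hs r0 Bs.
have near_r u : \forall z \near (0 : V), `|u| < r -> `|u + z| < r.
  have [ur|ur] := ltP `|u| r; last by apply: nearW.
  apply/near0_normP; exists (r - `|u|); first by rewrite subr_gt0.
  move=> z; rewrite ltrBrDl => zr _.
  exact: le_lt_trans (ler_normD _ _) zr.
(* every direction of [s] stays in [B] when started from the point [x + v] *)
have sL u : s u -> u \in L'.
  move=> su; have [e e0 eP] := near0_scale u (filterI (near_r v) (fB _ Bv)).
  have [|er /= eL] := eP e; first by rewrite gtr0_norm.
  have euL : e *: u \in L'.
    apply/eL; rewrite -addrA; apply/Bs; first exact: er.
    rewrite addrC -[v]scale1r; apply: relative_interior_ray => //.
    by apply: coneZ => //; exact: ltW.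
  by have := memvZ e^-1 euL; rewrite scalerA mulVf ?gt_eqF// scale1r.
have Lface u : u \in L -> facespan s 0 u.
  move=> uL; have [e e0 eP] := near0_scale u (filterI (near_r 0) (fA _ Ax)).
  have [|er /= eL] := eP e; first by rewrite gtr0_norm.
  have := er; rewrite normr0 => /(_ r0); rewrite add0r => {}er.
  have : facespan s 0 (e *: u).
    by rewrite -(chart_stratumE ch SA Ax Fs er); apply/eL; exact: memvZ.
  have [M ->] := facespan_vspace hs (cone0 hs).
  by move=> /(memvZ e^-1); rewrite scalerA mulVf ?gt_eqF// scale1r.
have LL' : (L <= L')%VS.
  by apply/subvP => u /Lface /(facespan0_sub hs) /sL.
rewrite ltnNge; apply/negP => dimL; apply: AB.
have LE : L = L' by apply/eqP; rewrite eqEdim LL'.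
have v0 : facespan s 0 v.
  by apply: Lface; rewrite LE; apply: sL; exact: relative_interior_sub sv.
apply: (cell_inj SA SB (x := x + v)) => //.
by rewrite (chart_stratumE ch SA Ax Fs vr).
Qed.

Lemma conical_fan_stratification : fan_stratifications X S.
Proof.
have [pS _ _] := hS; split.
  split => // [|A SA|A B SA SB AB [x [Ax [Bx _]]]].
  - exact: conical_locally_finite.
  - have cA := cell_connected SA; have [L fA] := cell_flat SA.
    split => //; first exact: flat_locally_closed fA.
    by exists (\dim L); exact: flat_submanifold.
  - split.
      move=> y Ay; split; last exact: cell_sub Ay.
      exact: (cell_frontier SA SB Ax).
    have [L fA] := cell_flat SA; have [L' fB] := cell_flat SB.
    exists (\dim L), (\dim L'); split; [exact: flat_submanifold..|].
    exact: cell_dim SA SB AB Ax Bx fA fB.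
move=> x Xx; have [F [r ch]] := conical_chart Xx; have [r0 fanF SF FS] := ch.
exists F, (ball x r); split => //; [exact: ball_open | exact: ballxx |].
have compE A s y : F s -> models A x r s -> (A `&` ball x r) y ->
    connected_component (A `&` ball x r) y =
    translate x (relative_interior s) `&` ball x r.
  move=> Fs As Ay; rewrite connected_component_id ?(models_ball As)//.
    by rewrite -(models_ball As).
  rewrite -(models_ball As); apply: convex_connected.
  by apply: models_convex As; exact: fan_cone Fs.
apply/seteqP; split=> [_ [A SA [y Ay <-]]|_ [s Fs <-]].
  have := Ay => -[Ay1]; rewrite -[y](subrK x) addrC ballDE => yr.
  have [|s Fs As] := SF A (y - x) SA yr; first by rewrite addrC subrK.
  by exists s => //; rewrite [x + _]addrC subrK; exact/esym/compE.
have [A SA As] := FS s Fs; exists A => //.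
have [v [vr sv Av]] := models_neq0 (fan_cone fanF Fs) r0 As.
have Av' : (A `&` ball x r) (x + v) by split => //; rewrite ballDE.
by exists (x + v) => //; exact: compE.
Qed.

End Conical.
End ConicalPartitions.

(** * From local to global convexity *)

Section LocalToGlobal.
Context {R : realType} {V : normedVectType R}.
Implicit Types (A C D K X : set V) (x y a b c u v w : V) (r t e : R).
Implicit Types (L : {vspace V}).

Definition seg x y : set V := [set x + t *: (y - x) | t in `[0, 1]].

Lemma segP x y z :
  seg x y z <-> exists t, [/\ 0 <= t, t <= 1 & z = x + t *: (y - x)].
Proof.
split=> [[t /= + <-]|[t [t0 t1 ->]]].
  by rewrite in_itv/= => /andP[t0 t1]; exists t.
by exists t => //=; rewrite in_itv/= t0.
Qed.

Lemma seg_l x y : seg x y x.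
Proof. by apply/segP; exists 0; rewrite lexx ler01 scale0r addr0. Qed.

Lemma seg_r x y : seg x y y.
Proof. by apply/segP; exists 1; rewrite lexx ler01 scale1r addrC subrK. Qed.

Lemma seg_convex x y : convex (seg x y).
Proof.
move=> _ _ t /segP[p [p0 p1 ->]] /segP[q [q0 q1 ->]] t0 t1.
apply/segP; exists (p + t * (q - p)); split; last by lmod_ring.
  by rewrite (_ : _ + _ = (1 - t) * p + t * q); [nra | ring].
by rewrite (_ : _ + _ = (1 - t) * p + t * q); [nra | ring].
Qed.

Lemma seg_sub A x y : convex A -> A x -> A y -> seg x y `<=` A.
Proof. by move=> cA Ax Ay _ /segP[t [t0 t1 ->]]; exact: cA. Qed.

Lemma seg_connected x y : connected (seg x y).
Proof. exact/convex_connected/seg_convex. Qed.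

Lemma closed_in_convexP X : closed_in_convex X ->
  exists C, [/\ convex C, X `<=` C & forall x, C x -> closure X x -> X x].
Proof.
move=> [C [/convex_setP cC XC /closed_subspaceP[D clD DX]]].
exists C; split => // x Cx.
have XD : X `<=` D.
  move=> y Xy; have : (X `&` C) y by split => //; exact: XC.
  by rewrite -DX => -[].
move=> /(closureS XD); rewrite -(closure_id D).1// => Dx.
by have : (D `&` C) x by []; rewrite DX => -[].
Qed.

(** By compactness of the segment from [a] to [b]. *)
Lemma near_seg A L a b : flat L A -> seg a b `<=` A -> b - a \in L ->
  \forall u \near 0, A (b + u) -> seg a (b + u) `<=` A.
Proof.
move=> fA abA abL.
have cpt : compact (`[0, 1]%classic : set R) by exact: segment_compact.
have Ab : A b by apply: abA; exact: seg_r.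
suff : \forall u \near (0 : V), `[0, 1]%classic `<=`
    (fun t : R => u \in L -> A (a + t *: (b + u - a))).
  apply: filterS2 (fA b Ab) => u bu uP /bu uL _ [t t01 <-].
  exact: uP.
move: cpt => /compact_near_coveringP; apply => t t01.
have At : A (a + t *: (b - a)) by apply: abA; exists t.
pose h (p : R * V) : V := (p.1 - t) *: (b - a) + p.1 *: p.2.
have ch : h p @[p --> (t, 0 : V)] --> (0 : V).
  rewrite [X in _ --> X](_ : 0 = (t - t) *: (b - a) + t *: 0); last first.
    by rewrite subrr scale0r scaler0 addr0.
  apply: cvgD.
    by apply: cvgZr_tmp; apply: cvgB; [exact: cvg_fst | exact: cvg_cst].
  by apply: cvgZ; [exact: cvg_fst | exact: cvg_snd].
have := ch _ (fA _ At); rewrite /nbhs/=; apply: filterS => -[t' u] /=.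
rewrite /h/= => [[_ hA]] uL.
rewrite (_ : a + _ = a + t *: (b - a) + ((t' - t) *: (b - a) + t' *: u)).
  by apply: hA; apply: memvD; exact: memvZ.
by lmod_ring.
Qed.

(** Near a limit point [x] the set [A] may consist of several pieces; each piece
    is required to lie in a convex part of [A], which may depend on it. *)
Definition piecewise_convex X A :=
  forall x, X x -> closure A x -> exists2 r, 0 < r &
    forall c, A c -> ball x r c -> exists K, [/\ convex K, K `<=` A &
      forall D, connected D -> D c -> D `<=` A `&` ball x r -> D `<=` K].

(** The limit segment lies in [X]; its points in [A] form an open and closed
    part. For closedness, let [y] be a limit of points of [A] on the segment,
    take such a point [c] near [y] and let [y'] lie on the other side of [y].
    For [b + u] in [A] near [b], a path in [A] leads from [c] to the segment
    from [a] to [b + u] and along it to a point [d'] near [y']; so [d'] belongs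
    to the same convex part of [A] as [c] and its neighbours in the direction of
    [A]. One of these neighbours is the point that has [y] on its segment to
    [d']. *)
Lemma seg_limit X A L a b : closed_in_convex X -> A `<=` X -> connected A ->
  flat L A ->
  piecewise_convex X A ->
  A a -> A b -> closure [set b' | A b' /\ seg a b' `<=` A] b -> seg a b `<=` A.
Proof.
move=> /closed_in_convexP[C [cC XC clX]] AX cA fA locA Aa Ab clb.
have Lba : b - a \in L by exact: flat_sub Aa Ab.
suff h : seg a b `<=` seg a b `&` A by move=> y /h[].
apply: connected_ind; [exact: seg_connected | by move=> y [] | | | ].
- by exists a; split => //; exact: seg_l.
- move=> y [/segP[p [_ _ yE]] Ay]; apply: filterS (fA y Ay) => v hv yvS.
  split => //; apply/hv; move: yvS => /segP[q [_ _ /(canRL (addKr _)) ->]].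
  rewrite (_ : _ + _ = (q - p) *: (b - a)); first exact: memvZ.
  by rewrite yE; lmod_ring.
move=> y yS cly; split => //.
have cAy : closure A y by move: cly; apply: closureS => z [].
have Xy : X y.
  apply: clX; last by move: cAy; exact: closureS.
  by apply: (seg_sub cC _ _ yS); exact/XC/AX.
have [r r0 locy] := locA y Xy cAy.
have [p [p0 p1 yE]] := (segP a b y).1 yS.
have [p00|pN0] := eqVneq p 0; first by rewrite yE p00 scale0r addr0.
have [p11|pN1] := eqVneq p 1; first by rewrite yE p11 scale1r addrC subrK.
have {pN0}p0 : 0 < p by rewrite lt_def pN0.
have {pN1}p1 : p < 1 by rewrite lt_neqAle pN1.
have [w wr [/segP[q [q0 q1 cE]] Ac]] := (closure_normP _ _).1 cly r r0.
set c := y + w in cE Ac.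
have cr : ball y r c by rewrite ballDE.
have [K [cK KA DK]] := locy c Ac cr.
(* continue the segment from c to y a little beyond y, inside the ball and
   inside the segment from a to b *)
have [m m0 [m1 m2 m3]] : exists2 m : R, 0 < m &
    [/\ ball y r (y + m *: (y - c)), 0 <= p + m * (p - q) &
        p + m * (p - q) <= 1].
  have : \forall v \near (0 : V), ball y r (y + v).
    by apply/near0_normP; exists r => // v; rewrite ballDE.
  move=> /(near0_scale (y - c))[e e0 eP].
  have d0 : 0 < Num.min e (Num.min p (1 - p)) by rewrite !lt_min e0 p0 subr_gt0.
  exists (Num.min e (Num.min p (1 - p))) => //; set m := Num.min _ _ in d0 *.
  have me : m <= e by rewrite ge_min lexx.
  have mp : m <= p by rewrite !ge_min lexx orbT.
  have mp1 : m <= 1 - p by rewrite !ge_min lexx !orbT.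
  split; [by apply: eP; rewrite gtr0_norm | nra | nra].
set p' := p + m * (p - q) in m2 m3.
set y' := y + m *: (y - c) in m1.
have y'E : y' = a + p' *: (b - a) by rewrite /y' cE yE /p'; lmod_ring.
have /near0_normP[d d0 dP] : \forall v \near 0,
    [/\ A (c + v) <-> v \in L, ball y r (c + v) & ball y r (y' + v)].
  near=> v; split; near: v; first exact: fA Ac.
    apply/near0_normP; exists (r - `|w|); first by rewrite subr_gt0.
    move=> v vr; rewrite /c -addrA ballDE.
    by apply: (le_lt_trans (ler_normD _ _)); rewrite -ltrBrDl.
  have := ball_open y r; rewrite openE => /(_ _ m1); exact: (nbhs0P _ _).1.
have short v t : `|v| < d -> 0 <= t -> t <= 1 -> `|t *: v| < d.
  move=> vd t0 t1; apply: le_lt_trans vd; rewrite normrZ ger0_norm//.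
  exact: ler_piMl.
have segc v : v \in L -> `|v| < d -> seg c (c + v) `<=` A `&` ball y r.
  move=> vL vd z /segP[t [t0 t1 ->]]; rewrite (addrC c v) addrK.
  have [hA hb _] := dP _ (short v t vd t0 t1).
  by split => //; apply/hA; exact: memvZ.
have k0 : 0 < d * Num.min 1 m by rewrite mulr_gt0// lt_min ltr01.
have [u uk [Abu abu]] := (closure_normP _ _).1 clb _ k0.
have uL : u \in L.
  by rewrite (_ : u = b + u - b) ?(flat_sub cA fA Ab Abu)//; lmod_ring.
have ud : `|u| < d by apply: (lt_le_trans uk); rewrite ger_pMr// ge_min lexx.
have um : `|u| < d * m.
  by apply: (lt_le_trans uk); rewrite ler_pM2l// ge_min lexx orbT.
set c' := c + q *: u; set d' := y' + p' *: u.
have Kd' : K d'.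
  apply: (DK (seg c c' `|` seg c' d')).
  - apply: connectedU; [|exact: seg_connected..].
    by exists c'; split; [exact: seg_r | exact: seg_l].
  - by left; exact: seg_l.
  - move=> z [|c'd'z].
      by apply: segc; [exact: memvZ | exact: short].
    split.
      apply: abu; apply: (seg_sub _ _ _ c'd'z); first exact: seg_convex.
        by apply/segP; exists q; split => //; rewrite /c' cE; lmod_ring.
      by apply/segP; exists p'; split => //; rewrite /d' y'E; lmod_ring.
    apply: (seg_sub (@ball_convex _ _ y r) _ _ c'd'z).
      by have [] := dP _ (short u q ud q0 q1).
    by have [] := dP _ (short u p' ud m2 m3).
  - by right; exact: seg_r.
(* y divides the segment from this neighbour of c to d' in the ratio 1 : m *)
have vd : `|- (p' / m) *: u| < d.
  rewrite normrZ normrN (ger0_norm (divr_ge0 m2 (ltW m0))).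
  rewrite mulrAC ltr_pdivrMr//; apply: le_lt_trans um.
  exact: ler_piMl.
have Kv : K (c - (p' / m) *: u).
  rewrite -scaleNr; apply: (DK (seg c (c + (- (p' / m)) *: u))).
  - exact: seg_connected.
  - exact: seg_l.
  - by apply: segc => //; exact: (memvZ (- (p' / m)) uL).
  - exact: seg_r.
have m1N0 : 1 + m != 0 by rewrite gt_eqF// addr_gt0.
apply: KA; have := cK _ _ (1 + m)^-1 Kv Kd'.
rewrite (_ : _ + _ *: _ = y); last first.
  rewrite /d' /y' /c; move: p' {m2 m3 y'E Kd' d' vd Kv} => p'.
  by lmod_field; rewrite gt_eqF.
apply; first by rewrite invr_ge0 addr_ge0// ltW.
by rewrite invf_le1 ?addr_gt0// lerDl ltW.
Unshelve. all: by end_near. Qed.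

(** A form of the Tietze-Nakajima theorem for sets that are not closed: the
    points of [A] that see [a] inside [A] form an open and closed part. *)
Lemma flat_convex X A L : closed_in_convex X -> A `<=` X -> connected A ->
  flat L A ->
  piecewise_convex X A ->
  convex A.
Proof.
move=> hX AX cA fA locA a b t Aa Ab t0 t1.
suff h : A `<=` [set b' | A b' /\ seg a b' `<=` A].
  by have [_] := h b Ab; apply; apply/segP; exists t.
apply: connected_ind => //.
- by move=> x [].
- by exists a; split => // z /segP[p [_ _ ->]]; rewrite subrr scaler0 addr0.
- move=> x [Ax axA].
  have := near_seg fA axA (flat_sub cA fA Aa Ax).
  by apply: filterS => u h Au; split => //; exact: h.
by move=> x Ax clx; split => //; exact: (seg_limit hX AX cA fA locA Aa Ax clx).
Qed.

End LocalToGlobal.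

(** * Stratifications locally modelled on fans are conical *)

Section FanStratifications.
Context {R : realType} {V : normedVectType R}.
Implicit Types (A B D s X : set V) (x u v w : V) (r t e : R).
Implicit Types (F S : set (set V)) (L : {vspace V}).

Lemma cell_convex X S A : closed_in_convex X -> conical_partition X S ->
  S A -> convex A.
Proof.
move=> hX hS SA; have [L fA] := cell_flat hS SA.
apply: (flat_convex hX (cell_sub hS SA) (cell_connected hS SA) fA) => x Xx clx.
have [F [r ch]] := conical_chart hS Xx; have [s Fs As] := chart_sub ch SA clx.
exists r; first exact: chart_gt0 ch.
move=> c Ac cr; exists (A `&` ball x r); split => //.
exact: models_convex (chart_cone ch Fs) As.
Qed.

Lemma submanifold_locally_connected d A x r : submanifold d A -> A x -> 0 < r ->
  exists D, [/\ connected D, D x, D `<=` A `&` ball x r &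
    \forall v \near 0, A (x + v) -> D (x + v)].
Proof.
move=> mA Ax r0.
have [U [W [f [L [Ux [oU oW fUW sf [g sg gf]] _ fAU]]]]] := mA x Ax.
have Wfx : W (f x) by rewrite -fUW; exists x.
have cf : {for x, continuous f} by have := sf 0; exact.
have cg y : W y -> {for y, continuous g} by have := sg 0; exact.
have : \forall y \near f x, W y /\ ball x r (g y).
  apply: filterI; first exact: open_nbhs_nbhs.
  by apply: (cg _ Wfx); rewrite gf//; exact: nbhsx_ballx.
move=> /nbhs_ballP[d' d'0 hd'].
have LW z : z \in L -> W z -> exists2 y, (A `&` U) y & f y = z.
  move=> zL Wz; have : ([set` L] `&` W) z by [].
  by rewrite -fAU => -[y AUy <-]; exists y.
exists (g @` ([set` L] `&` ball (f x) d')); split.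
- apply: connected_continuous_connected.
    apply: convex_connected; apply: convexI; last exact: ball_convex.
    move=> y z t /= yL zL _ _; apply: memvD => //; apply: memvZ; exact: memvB.
  apply: continuous_in_subspaceT => y /set_mem[_ /hd'[Wy _]]; exact: cg.
- exists (f x); last exact: gf.
  split; last exact: ballxx.
  have : (f @` (A `&` U)) (f x) by exists x.
  by rewrite fAU => -[].
- move=> _ [z [/= zL zd'] <-]; have [Wz gz] := hd' _ zd'; split => //.
  by have [y [Ay Uy] <-] := LW z zL Wz; rewrite gf.
have Unear : nbhs x U by exact: open_nbhs_nbhs.
have fnear := cf _ (nbhsx_ballx (f x) d' d'0).
have /nbhs0P/near0_normP[e e0 eP] : nbhs x (U `&` f @^-1` ball (f x) d').
  exact: filterI.
apply/near0_normP; exists e => // v /eP[Uv fv] Av.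
exists (f (x + v)); last by rewrite gf.
split => //; have : (f @` (A `&` U)) (f (x + v)) by exists (x + v).
by rewrite fAU => -[].
Qed.

Section FanModels.
Variables (X : set V) (S : set (set V)).
Hypothesis hS : fan_stratifications X S.

(** The local model restricted to a ball. The components of a stratum need not
    restrict to components, but connected parts of a stratum still stay in one
    cone, which is enough. *)
Lemma fan_model x : X x -> exists F r, [/\ 0 < r, fan F,
  forall A v, S A -> `|v| < r -> A (x + v) ->
    exists s, [/\ F s, relative_interior s v &
      forall D, connected D -> D (x + v) -> D `<=` A `&` ball x r ->
        D `<=` translate x (relative_interior s)] &
  forall s, F s -> exists2 A, S A &
    forall v, `|v| < r -> relative_interior s v -> A (x + v)].
Proof.
move=> Xx; have [_ /(_ x Xx)[F [U [fanF oU Ux FU]]]] := hS.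
have : nbhs x U by exact: open_nbhs_nbhs.
move=> /nbhs_ballP[r r0 rU]; exists F, r; split => //.
  move=> A v SA vr Av; have AUv : (A `&` U) (x + v).
    by split => //; apply: rU; rewrite ballDE.
  have : (\bigcup_(A in S) components (A `&` U))
      (connected_component (A `&` U) (x + v)) by exists A => //; exists (x + v).
  rewrite FU => -[s Fs sE]; exists s; split => //.
    by have := connected_component_refl AUv; rewrite -sE => -[/translateE].
  move=> D cD Dv DA y Dy.
  have : connected_component (A `&` U) (x + v) y.
    by exists D => //; split => // z /DA[Az /rU].
  by rewrite -sE => -[].
move=> s Fs.
have : (\bigcup_(A in S) components (A `&` U))
    (translate x (relative_interior s) `&` U) by rewrite FU; exists s.
move=> [A SA [y AUy yE]]; exists A => // v vr sv.
suff : (A `&` U) (x + v) by case.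
apply: (@connected_component_sub _ _ y); rewrite yE.
split; first exact/translateE.
by apply: rU; rewrite ballDE.
Qed.

Lemma stratum_inj A B x : S A -> S B -> A x -> B x -> A = B.
Proof.
by case: hS => -[[_ tS _] _ _ _] _ SA SB Ax Bx; apply: tS => //; exists x.
Qed.

Lemma stratum_sub A : S A -> A `<=` X.
Proof. by case: hS => -[[<- _ _] _ _ _] _ SA x Ax; exists A. Qed.

(** A submanifold is locally connected, so near its point [x] the stratum stays
    in the only cone of the fan with [0] in its relative interior. *)
Lemma stratum_flat A : S A -> exists L, flat L A.
Proof.
move=> SA; have [[_ _ /(_ A SA)[cA _ [d mA]] _] _] := hS.
apply: connected_flat => // x Ax; have Xx := stratum_sub SA Ax.
have [F [r [r0 fanF FA FS]]] := fan_model Xx.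
have [s [Fs s0 sD]] : exists s, [/\ F s, relative_interior s 0 &
    forall D, connected D -> D (x + 0) -> D `<=` A `&` ball x r ->
      D `<=` translate x (relative_interior s)].
  by apply: FA; rewrite ?normr0 ?addr0.
have hs := fan_cone fanF Fs; have sE := fan_lineality fanF Fs Fs s0.
have riE : relative_interior s = facespan s 0.
  by rewrite {1}sE relative_interior_lineality.
have [L LE] := facespan_vspace hs (cone0 hs); exists L.
have [B SB Bs] := FS s Fs.
have BA : B = A.
  apply: (stratum_inj SB SA _ Ax).
  by rewrite -[x]addr0; apply: Bs; rewrite ?normr0.
have [D [cD Dx DA Dnear]] := submanifold_locally_connected mA Ax r0.
have Ds := sD D cD _ DA; rewrite addr0 in Ds.
near=> v; split => [Av|vL].
  have : D (x + v) by apply: (near Dnear v).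
  by move=> /(Ds Dx)/translateE; rewrite riE LE.
have vr : `|v| < r by near: v; apply/near0_normP; exists r.
by rewrite -BA; apply: Bs => //; rewrite riE LE.
Unshelve. all: by end_near. Qed.

Lemma translate_ball_sub A x r s v : S A -> 
  (exists2 B, S B & forall v, `|v| < r -> relative_interior s v -> B (x + v)) ->
  `|v| < r -> relative_interior s v -> A (x + v) ->
  translate x (relative_interior s) `&` ball x r `<=` A.
Proof.
move=> SA [B SB Bs] vr sv Av; have <- : B = A.
  by apply: (stratum_inj SB SA _ Av); exact: Bs.
by move=> _ [[w sw <-]]; rewrite ballDE => wr; exact: Bs.
Qed.

Lemma stratum_convex A : closed_in_convex X -> S A -> convex A.
Proof.
move=> hX SA; have [[_ _ /(_ A SA)[cA _ _] _] _] := hS.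
have [L fA] := stratum_flat SA.
apply: (flat_convex hX (stratum_sub SA) cA fA) => x Xx clx.
have [F [r [r0 fanF FA FS]]] := fan_model Xx.
exists r => // c Ac; rewrite -[c](subrK x) addrC in Ac *; rewrite ballDE => cr.
have [s [Fs sc sD]] := FA A _ SA cr Ac.
exists (translate x (relative_interior s) `&` ball x r); split.
- apply: convexI; last exact: ball_convex.
  apply: translate_convex; apply: relative_interior_convex.
  exact: fan_cone Fs.
- exact: translate_ball_sub (FS s Fs) cr sc Ac.
- move=> D cD Dc DA y Dy; split; first exact: sD Dy.
  by have [] := DA y Dy.
Qed.

(** A convex stratum meets the ball in a connected set, hence in one cone. *)
Lemma fan_stratification_conical : closed_in_convex X -> conical_partition X S.
Proof.
move=> hX; have [[pS _ hcell _] _] := hS; split => //.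
  by move=> A /hcell[].
move=> x Xx; have [F [r [r0 fanF FA FS]]] := fan_model Xx.
have FA' A v : S A -> `|v| < r -> A (x + v) -> exists s, 
    [/\ F s, relative_interior s v & models A x r s].
  move=> SA vr Av; have [s [Fs sv sD]] := FA A v SA vr Av.
  exists s; split => // w wr; split=> [Aw|sw].
    apply/(translateE x); apply: (sD (A `&` ball x r)) => //.
    - apply: convex_connected; apply: convexI; last exact: ball_convex.
      exact: stratum_convex.
    - by split => //; rewrite ballDE.
    - by split => //; rewrite ballDE.
  apply: (translate_ball_sub SA (FS s Fs) vr sv Av).
  by rewrite /= ballDE; split => //; exact/translateE.
exists F, r; split => // [A v SA vr Av|s Fs].
  by have [s [Fs _ As]] := FA' A v SA vr Av; exists s.
have hs := fan_cone fanF Fs; have [A SA As] := FS s Fs; exists A => //.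
have [w sw] := relative_interior_neq0 hs.
have : \forall v \near (0 : V), `|v| < r by apply/near0_normP; exists r.
move=> /(near0_scale w)[e e0 /(_ e)]; rewrite gtr0_norm// lexx => /(_ erefl) er.
have sew := relative_interiorZ hs sw e0.
have [s' [Fs' s'w As']] := FA' A _ SA er (As _ er sew).
by rewrite (fan_interior_inj fanF Fs Fs' sew s'w).
Qed.

End FanModels.
End FanStratifications.

(** * Closures of cells form a chamber decomposition *)

Section ClosuresOfCells.
Context {R : realType} {V : normedVectType R}.
Implicit Types (A B D P s : set V) (x y u v w : V) (r t e : R).
Implicit Types (F : set (set V)) (L : {vspace V}).
Variables (X : set V) (S : set (set V)).
Hypothesis hS : conical_partition X S.

Lemma closure_sub A B : A `<=` closure B -> closure A `<=` closure B.
Proof.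
move=> AB; rewrite [X in _ `<=` X](closure_id (closure B)).1.
  exact: closureS.
exact: closed_closure.
Qed.

Definition face_class P x : set V :=
  [set y | P y /\ local_face P x = local_face P y].

Lemma chart_support F x r s v : chart S x F r -> F s -> `|v| < r -> s v ->
  X (x + v).
Proof.
move=> ch Fs vr sv; have [_ fanF _ FS] := ch.
have [Fs' s'v] := fan_carrier fanF Fs sv.
have [B SB Bs] := FS _ Fs'.
by apply: (cell_sub hS SB); exact/Bs.
Qed.

Lemma closure_in_models F x r A s v : chart S x F r -> F s -> models A x r s ->
  `|v| < r -> closure_in X A (x + v) <-> s v.
Proof.
move=> ch Fs As vr; have hs := chart_cone ch Fs.
split; first by move=> [+ _] => /(models_closure hs As vr).
by move=> sv; split;
  [exact/(models_closure hs As vr) | exact: (chart_support ch Fs vr sv)].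
Qed.

Lemma closure_in_local_cone F x r A s :
  chart S x F r -> F s -> models A x r s ->
  is_local_cone (closure_in X A) x s.
Proof.
move=> ch Fs As; apply/is_local_coneP; split; first exact: (chart_cone ch Fs).
apply/near0_normP; exists r; first exact: (chart_gt0 ch).
by move=> v vr; exact: (closure_in_models ch Fs As vr).
Qed.

Lemma closure_in_locally_polyhedral A : S A ->
  locally_polyhedral (closure_in X A).
Proof.
move=> SA x [clx Xx]; have [F [r ch]] := conical_chart hS Xx.
have [s Fs As] := chart_sub ch SA clx; exists s.
exact: (closure_in_local_cone ch Fs As).
Qed.

(** Both sides are the lineality space of the fan at [x]; in particular the local
    face does not depend on [A]. *)
Lemma local_face_closure_in A B L x : S A -> S B -> B x -> closure A x ->
  flat L B -> local_face (closure_in X A) x = [set` L].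
Proof.
move=> SA SB Bx clx fB; have [F [r ch]] := conical_chart hS (cell_sub hS SB Bx).
have [s Fs As] := chart_sub ch SA clx; have hs := chart_cone ch Fs.
rewrite (local_faceE (closure_in_local_cone ch Fs As)).
have [L' LE] := facespan_vspace hs (cone0 hs); rewrite LE.
suff -> : L' = L by [].
apply: vspace_germ; near=> v.
have vr : `|v| < r.
  by near: v; apply/near0_normP; exists r => //; exact: (chart_gt0 ch).
have h1 := chart_stratumE ch SB Bx Fs vr; rewrite LE /= in h1.
have h2 : B (x + v) <-> v \in L by near: v; exact: fB.
by apply/idP/idP; tauto.
Unshelve. all: by end_near. Qed.

(** The cell [B] lies in the class because its local face is constant. No other
    point [y + v] near a point [y] of [B] is in the class: [v] belongs to the
    local face at [y + v], so if that face is still the direction of [B], then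
    [y + v] is in [B]. *)
Lemma face_class_component A B x : S A -> S B -> B x -> closure A x ->
  connected_component (face_class (closure_in X A) x) x = B.
Proof.
move=> SA SB Bx clx; set P := closure_in X A.
have [L fB] := cell_flat hS SB.
have BP y : B y -> P y.
  move=> By; split; last exact: (cell_sub hS SB By).
  exact: (cell_frontier hS SB SA Bx).
have xL := local_face_closure_in SA SB Bx clx fB.
apply/seteqP; split; last first.
  apply: connected_component_max => //; last exact: (cell_connected hS SB).
  move=> y By; split; first exact: BP.
  by rewrite xL (local_face_closure_in SA SB By _ fB)//; have [] := BP y By.
set D := connected_component _ _.
have DP y : D y -> P y /\ local_face P y = [set` L].
  by move=> /connected_component_sub[Py e]; rewrite -xL e.
have Dnear y B' : D y -> S B' -> B' y ->
    \forall v \near 0, D (y + v) -> B' (y + v).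
  move=> Dy SB' B'y; have [[cly Xy] yL] := DP y Dy.
  have [L' fB'] := cell_flat hS SB'.
  have := local_face_closure_in SA SB' B'y cly fB'; rewrite -/P yL => LL'.
  have [s ys] := closure_in_locally_polyhedral SA (conj cly Xy).
  apply: filterS2 (local_face_near ys) (fB' y B'y) => v [ysv yvs] hv Dyv.
  have [Pyv yvL] := DP _ Dyv; have sv : s v by exact/ysv.
  apply/hv; suff : [set` L'] v by [].
  by rewrite -LL' -yvL (yvs sv); apply: facespan_refl => //; case: ys.
suff h : D `<=` D `&` B by move=> y /h[].
have Dx : D x by apply: connected_component_refl; split => //; exact: BP.
apply: connected_ind;
  [exact: component_connected | by move=> y [] | by exists x | | ].
  move=> y [Dy By]; apply: filterS (Dnear y B Dy SB By) => v h Dv.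
  by split => //; exact: h.
move=> y Dy clDB; split => //; have [[_ Xy] _] := DP y Dy.
have [B' SB' B'y] := cell_ex hS Xy.
have /near0_normP[e e0 eB'] := Dnear y B' Dy SB' B'y.
have [v ve [Dv Bv]] := (closure_normP _ _).1 clDB e e0.
by rewrite (cell_inj hS SB SB' Bv (eB' v ve Dv)).
Qed.

Lemma strata_closure_in A : S A ->
  strata (closure_in X A) = [set B | S B /\ B `<=` closure A].
Proof.
move=> SA; set P := closure_in X A.
apply/seteqP; split=> [_ [x Px [y [Py xy] <-]]|B].
  have [cly Xy] := Py; have [B SB By] := cell_ex hS Xy.
  have -> : [set z | P z /\ local_face P x = local_face P z] = face_class P y.
    by rewrite /face_class -xy.
  rewrite (face_class_component SA SB By cly); split => //.
  exact: (cell_frontier hS SB SA By).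
move=> [SB BA]; have [x Bx] := cell_neq0 hS SB; have clx := BA x Bx.
have Px : P x by split => //; exact: (cell_sub hS SB Bx).
by exists x => //; exists x => //; exact: face_class_component.
Qed.

Lemma strata_of_closures : strata_of_decomposition (closures_of_strata X S) = S.
Proof.
apply/seteqP; split=> [B [_ [A SA <-]]|A SA].
  by rewrite strata_closure_in// => -[].
exists (closure_in X A); first by exists A.
by rewrite strata_closure_in//; split => //; exact: subset_closure.
Qed.

(** The cone of [D] at [x] is the intersection of those of [A] and [B], which
    belongs to the fan. *)
Lemma closure_meet A B x : S A -> S B -> X x -> closure A x -> closure B x ->
  exists D, [/\ S D, D `<=` closure A, D `<=` closure B &
    \forall v \near 0, closure A (x + v) -> closure B (x + v) ->
      closure D (x + v)].
Proof.
move=> SA SB Xx Ax Bx; have [F [r ch]] := conical_chart hS Xx.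
have [s Fs As] := chart_sub ch SA Ax; have [s' Fs' Bs'] := chart_sub ch SB Bx.
have hs := chart_cone ch Fs; have hs' := chart_cone ch Fs'.
have Fss' : F (s `&` s').
  by apply: (fan_face (chart_fan ch) Fs); exact: (fanI (chart_fan ch) Fs Fs').
have hss' := chart_cone ch Fss'; have r0 := chart_gt0 ch.
have [_ _ _ /(_ _ Fss')[D SD Ds]] := ch.
have [v [vr sv Dv]] := models_neq0 hss' r0 Ds.
have [s1 s2] := relative_interior_sub sv.
exists D; split => //.
- by apply: (cell_frontier hS SD SA Dv); exact/(models_closure hs As).
- by apply: (cell_frontier hS SD SB Dv); exact/(models_closure hs' Bs').
apply/near0_normP; exists r => // w wr.
move=> /(models_closure hs As wr) sw /(models_closure hs' Bs' wr) s'w.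
exact/(models_closure hss' Ds wr).
Qed.

Hypothesis hX : closed_in_convex X.

Lemma closure_in_convex A : S A -> convex (closure_in X A).
Proof.
move=> SA; have [C [cC XC clX]] := closed_in_convexP hX.
move=> x y t [Ax Xx] [Ay Xy] t0 t1.
have cl := convex_closure (cell_convex hX hS SA) Ax Ay t0 t1.
split => //; apply: clX; first by apply: cC => //; exact: XC.
by apply: closureS cl; exact: (cell_sub hS SA).
Qed.

(** Being convex, the intersection is connected. The part of it near which it
    lies in the closure of one fixed cell [D] is open, and it is closed since the
    cells that describe the intersection at nearby points have comparable
    closures. *)
Lemma closure_in_meet A B : S A -> S B ->
  closure_in X A `&` closure_in X B !=set0 ->
  exists D, [/\ S D, D `<=` closure A, D `<=` closure B &
    closure_in X A `&` closure_in X B = closure_in X D].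
Proof.
move=> SA SB [x [[Ax Xx] [Bx _]]]; set Q := _ `&` _.
have [D [SD DA DB Dx]] := closure_meet SA SB Xx Ax Bx; exists D; split => //.
pose near_D y := \forall v \near 0, Q (y + v) -> closure D (y + v).
have QD : Q `<=` Q `&` near_D.
  apply: connected_ind => //.
  - by apply: convex_connected; apply: convexI; exact: closure_in_convex.
  - by exists x; split => //; apply: filterS Dx => v h [[? _] [? _]]; exact: h.
  - move=> y [_ /near0_near]; apply: filterS => v h Qv; split => //.
    by apply: filterS h => u; rewrite addrA.
  move=> y Qy cly; split => //; have [[Ay Xy] [By _]] := Qy.
  have [D' [SD' D'A D'B D'y]] := closure_meet SA SB Xy Ay By.
  suff DD' : D' `<=` closure D.
    apply: filterS D'y => v h [[? _] [? _]].
    by apply: (closure_sub DD'); exact: h.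
  have /near0_normP[e e0 eD'] := D'y.
  have [v ve [[[Av Xv] [Bv _]] /near0_normP[d d0 dD]]] :=
    (closure_normP _ _).1 cly e e0.
  have [u ud D'u] := (closure_normP _ _).1 (eD' v ve Av Bv) d d0.
  apply: (cell_frontier hS SD' SD D'u); apply: dD => //.
  have Xvu := cell_sub hS SD' D'u.
  by split; split => //; [exact: D'A | exact: D'B].
apply/seteqP; split=> y.
  move=> Qy; have [_ /nbhs_singleton] := QD y Qy; rewrite addr0 => /(_ Qy) Dy.
  by split => //; case: Qy => -[].
move=> [Dy Xy].
by split; split => //; [exact: (closure_sub DA) | exact: (closure_sub DB)].
Qed.

Lemma closures_chamber_decomposition :
  chamber_decomposition X (closures_of_strata X S).
Proof.
split.
- split.
    apply/seteqP; split=> [x [_ [A SA <-]] []//|x Xx].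
    have [A SA Ax] := cell_ex hS Xx; exists (closure_in X A); first by exists A.
    by split => //; exact: subset_closure.
  move=> x Xx; have [U xU finU] := conical_locally_finite hS Xx.
  exists U°; first by apply: open_nbhs_nbhs; split; [exact: open_interior|].
  apply: (@sub_finite_set _ _
    (closure_in X @` [set A | S A /\ A `&` U !=set0])).
    move=> _ /= [[A SA <-] [y [[Ay _] Uy]]]; exists A => //; split => //.
    by have [z [Az Uz]] := Ay _ Uy; exists z.
  exact: finite_image.
- move=> _ [A SA <-]; split; last exact: closure_in_locally_polyhedral.
  have [x Ax] := cell_neq0 hS SA; exists x.
  by split; [exact: subset_closure | exact: (cell_sub hS SA Ax)].
- move=> _ B [A SA <-]; rewrite strata_closure_in// => -[SB _].
  by exists B.
move=> _ _ [A SA <-] [B SB <-] /(closure_in_meet SA SB)[D [SD DA DB ->]].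
by exists D; rewrite !strata_closure_in.
Qed.

End ClosuresOfCells.

(** * Strata of a locally polyhedral set *)

Section StrataOfLocallyPolyhedral.
Context {R : realType} {V : normedVectType R}.
Implicit Types (A P s : set V) (x y z u v w : V) (r e : R).

Lemma face_refl s : polyhedral_cone s -> face s s.
Proof.
move=> hs; have [v] := relative_interior_neq0 hs.
rewrite relative_interiorE// => -[sv sF].
by rewrite -[X in face _ X](setIidl sF); exact: facespan_face.
Qed.

Lemma strata_component P A z : strata P A -> A z ->
  A = connected_component (face_class P z) z.
Proof.
move=> [x Px [y Py <-]] yz; rewrite (same_connected_component yz).
have [_ xz] := connected_component_sub yz.
by rewrite /face_class -xz.
Qed.

Lemma component_strata P z : P z ->
  strata P (connected_component (face_class P z) z).
Proof. by move=> Pz; exists z => //; exists z. Qed.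

(** Near [x] the points of [P] with the same face as a given point form the
    relative interior of one face of the local cone: a convex set, hence part of
    a single component. *)
Lemma strata_chart P x s : is_local_cone P x s ->
  exists r, chart (strata P) x (face s) r.
Proof.
move=> Ps; have hs : polyhedral_cone s by case: Ps.
have /near0_normP[r r0 rP] := local_face_near Ps.
have modelP v : `|v| < r -> s v ->
    models (connected_component (face_class P (x + v)) (x + v)) x r
      (s `&` facespan s v).
  move=> vr sv w wr; have [Pxv /(_ sv) fv] := rP v vr.
  have hf := face_cone hs (facespan_face hs sv).
  have riE u : relative_interior (s `&` facespan s v) u <->
      s u /\ facespan s u = facespan s v.
    by rewrite relative_interior_face.
  split=> [/connected_component_sub[/(rP w wr).1 sw]|fw].
    by rewrite fv ((rP w wr).2 sw) => vw; apply/riE.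
  set K := translate x (relative_interior (s `&` facespan s v)) `&` ball x r.
  apply: (@connected_component_max _ _ K).
  - by split; [apply/translateE/riE | rewrite ballDE].
  - move=> _ [[u /riE[su uv] <-]]; rewrite ballDE => ur; split.
      exact/(rP u ur).1.
    by rewrite fv ((rP u ur).2 su) uv.
  - apply: convex_connected; apply: convexI; last exact: ball_convex.
    by apply: translate_convex; exact: relative_interior_convex.
  - by split; [exact/translateE | rewrite ballDE].
exists r; split => //; first exact: faces_fan.
  move=> A v PA vr Av; rewrite (strata_component PA Av).
  have sv : s v.
    apply/(rP v vr).1.
    by have := Av; rewrite (strata_component PA Av);
      move=> /connected_component_sub[].
  by exists (s `&` facespan s v); [exact: facespan_face | exact: modelP].
move=> f sf; have hf := face_cone hs sf.
have [w fw] := relative_interior_neq0 hf.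
have : \forall v \near (0 : V), `|v| < r by apply/near0_normP; exists r.
move=> /(near0_scale w)[e e0 /(_ e)]; rewrite gtr0_norm// lexx => /(_ erefl) er.
have few := relative_interiorZ hf fw e0.
have fE := face_facespan hs sf few.
have sew : s (e *: w).
  by have := relative_interior_sub few; rewrite {1}fE => -[].
exists (connected_component (face_class P (x + e *: w)) (x + e *: w)).
  by apply: component_strata; exact/(rP _ er).1.
by rewrite fE; exact: modelP.
Qed.

Lemma strata_conical P : locally_polyhedral P -> conical_partition P (strata P).
Proof.
move=> lP; split.
- split.
  + apply/seteqP; split=> z.
      by move=> [A [x Px [y _ <-]]] /connected_component_sub[].
    move=> Pz; exists (connected_component (face_class P z) z).
      exact: component_strata.
    exact: connected_component_refl.
  + move=> A B PA PB [z [Az Bz]].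
    by rewrite (strata_component PA Az) (strata_component PB Bz).
  + move=> A [x Px [y Py <-]]; exists y; exact: connected_component_refl.
- by move=> A [x Px [y Py <-]]; exact: component_connected.
- by move=> x Px; have [s Ps] := lP x Px; exists (face s); exact: strata_chart.
Qed.

End StrataOfLocallyPolyhedral.

(** * Strata of a chamber decomposition *)

Lemma near_finite (T : eqType) (U : Type) (F : set_system U) (A : set T)
    (Q : T -> U -> Prop) : Filter F -> finite_set A ->
  (forall a, A a -> \forall u \near F, Q a u) ->
  \forall u \near F, forall a, A a -> Q a u.
Proof.
move=> FF /finite_seqP[q ->]; elim: q => [|b q IH] hQ; first exact: nearW.
have hb : \forall u \near F, Q b u by apply: hQ; rewrite /= mem_head.
have hq : \forall u \near F, forall a, a \in q -> Q a u.
  by apply: IH => a aq; apply: hQ; rewrite /= in_cons aq orbT.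
by apply: filterS2 hb hq => u ub uq a /=; rewrite in_cons => /predU1P[->|/uq].
Qed.

Section ChamberDecompositions.
Context {R : realType} {V : normedVectType R}.
Implicit Types (A B D P s : set V) (x y z u v w : V) (r e : R).
Variables (X : set V) (C : set (set V)).
Hypothesis hC : chamber_decomposition X C.

Let S := strata_of_decomposition C.

Lemma chamber_locally_polyhedral P : C P -> locally_polyhedral P.
Proof. by case: hC => _ h _ _ /h[]. Qed.

Lemma chamber_conical P : C P -> conical_partition P (strata P).
Proof. by move=> CP; exact/strata_conical/chamber_locally_polyhedral. Qed.

(** Apply the intersection axiom to the chamber and itself. *)
Lemma chamber_closure P : C P -> exists2 A, strata P A & P = closure_in X A.
Proof.
case: hC => _ neP _ meetP CP; have [P0 _] := neP P CP.
have [|A [PA _ PE]] := meetP P P CP CP; first by rewrite setIid.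
by exists A => //; rewrite -PE setIid.
Qed.

Lemma chamber_closed P x : C P -> X x -> closure P x -> P x.
Proof.
move=> CP Xx; have [A _ PE] := chamber_closure CP.
rewrite {2}PE => clx; split => //; apply: closure_sub clx.
by rewrite PE => y [].
Qed.

Lemma chamber_sub P : C P -> P `<=` X.
Proof. by case: hC => -[<- _] _ _ _ CP x Px; exists P. Qed.

Lemma closure_in_chamber P A : C P -> strata P A ->
  closure_in X A = closure_in P A.
Proof.
move=> CP PA; apply/seteqP; split=> x [clx Xx]; split => //.
  apply: chamber_closed => //; apply: closureS clx.
  exact: (cell_sub (chamber_conical CP) PA).
exact: chamber_sub CP _ Xx.
Qed.

Lemma stratum_chamber A : S A ->
  C (closure_in X A) /\ strata (closure_in X A) A.
Proof.
move=> [P CP PA]; split; first by case: hC => _ _ h _; exact: h PA.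
rewrite (closure_in_chamber CP PA) (strata_closure_in (chamber_conical CP) PA).
by split => //; exact: subset_closure.
Qed.

(** The two closures are chambers through [z], so they meet in the closure of a
    common stratum [D]. Inside the first chamber [A] meets the closure of [D],
    which therefore contains [A]; and [D] lies in the second chamber. *)
Lemma decomposition_frontier A B z : S A -> S B -> A z -> closure B z ->
  A `<=` closure B.
Proof.
move=> SA SB Az clz; have [CA AA] := stratum_chamber SA.
have [CB BB] := stratum_chamber SB.
have Xz : X z.
  have [P CP PA] := SA; apply: (chamber_sub CP).
  exact: (cell_sub (chamber_conical CP) PA Az).
have [_ _ _ meetC] := hC.
have [|D [AD BD DE]] := meetC _ _ CA CB.
  by exists z; split; split => //; exact: subset_closure.
have clDz : closure D z.
  suff : closure_in X D z by case.
  by rewrite -DE; split; split => //; exact: subset_closure.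
apply: subset_trans (cell_frontier (chamber_conical CA) AA AD Az clDz) _.
apply: closure_sub => y Dy.
by have [] := cell_sub (chamber_conical CB) BD Dy.
Qed.

(** Strata that meet have the same closure, and within that one chamber the
    strata are disjoint. *)
Lemma decomposition_inj A B z : S A -> S B -> A z -> B z -> A = B.
Proof.
move=> SA SB Az Bz.
have AB : A `<=` closure B.
  by apply: (decomposition_frontier SA SB Az); exact: subset_closure.
have BA : B `<=` closure A.
  by apply: (decomposition_frontier SB SA Bz); exact: subset_closure.
have [CA AA] := stratum_chamber SA; have [CB BB] := stratum_chamber SB.
have E : closure_in X A = closure_in X B.
  by apply/seteqP; split=> y [cly Xy]; split => //;
    [exact: (closure_sub AB) | exact: (closure_sub BA)].
rewrite -E in BB.
exact: (cell_inj (chamber_conical CA) AA BB Az Bz).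
Qed.

Lemma closure_in_stratum_cone P x s r A f :
  C P -> chart (strata P) x (face s) r -> strata P A -> face s f ->
  models A x r f -> is_local_cone (closure_in X A) x f.
Proof.
move=> CP ch PA sf Af; rewrite (closure_in_chamber CP PA).
exact: (closure_in_local_cone (chamber_conical CP) ch sf Af).
Qed.

Definition chamber_cones x : set (set V) :=
  [set s | exists P, [/\ C P, P x & is_local_cone P x s]].

(** A face of the local cone of [P] is the local cone of the closure of a stratum
    of [P]. The intersection of the local cones of two chambers is the local cone
    of their intersection, the closure of a common stratum, hence a face of
    both. *)
Lemma chamber_cones_fan x : X x -> fan (chamber_cones x).
Proof.
move=> Xx; have [[_ lfC] _ faceC meetC] := hC.
have coneC s : chamber_cones x s -> polyhedral_cone s by move=> [P [_ _ []]].
split => //.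
  have [U xU finU] := lfC x Xx.
  apply: (@sub_finite_set _ _
    (local_cone^~ x @` [set P | C P /\ P `&` U !=set0])).
    move=> s [P [CP Px Ps]]; exists P; last exact: local_coneE.
    by split => //; exists x; split => //; exact: nbhs_singleton.
  exact: finite_image.
split.
- move=> s Fs; have hs := coneC s Fs; split; first exact: polyhedral_cone_set.
  by exists 0; exact: cone0.
- move=> s f [P [CP Px Ps]] sf; have [r ch] := strata_chart Ps.
  have [r0 _ _ /(_ f sf)[A PA Af]] := ch.
  exists (closure_in X A); split; first exact: faceC PA.
    split => //; apply: models_center r0 Af.
    by apply: face_cone sf; case: Ps.
  exact: closure_in_stratum_cone CP ch PA sf Af.
move=> s s' [P [CP Px Ps]] [P' [CP' Px' Ps']] _.
have [|D [PD PD' DE]] := meetC P P' CP CP'; first by exists x.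
have clD : closure D x.
  have : closure_in X D x by rewrite -DE.
  by case.
have [r ch] := strata_chart Ps; have [r' ch'] := strata_chart Ps'.
have [f sf Df] := chart_sub ch PD clD.
have [f' sf' Df'] := chart_sub ch' PD' clD.
have Qf := closure_in_stratum_cone CP ch PD sf Df.
have Qf' := closure_in_stratum_cone CP' ch' PD' sf' Df'.
have Qss' : is_local_cone (closure_in X D) x (s `&` s').
  rewrite -DE; move: Ps Ps' => /is_local_coneP[hs Ps] /is_local_coneP[hs' Ps'].
  apply/is_local_coneP; split; first exact: polyhedral_coneI.
  by apply: filterS2 Ps Ps' => v h h'; split=> -[/h ? /h' ?].
have -> : s `&` s' = f by rewrite -(local_coneE Qf) -(local_coneE Qss').
by split => //; rewrite -(local_coneE Qf) (local_coneE Qf').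
Qed.

(** Local finiteness leaves finitely many chambers near [x]; those that do not
    contain [x] are avoided since chambers are closed in [X], and the others have
    charts of some radius. *)
Lemma chamber_ball x : X x -> exists2 r, 0 < r & forall P v, C P ->
  `|v| < r -> P (x + v) ->
  P x /\ forall s, is_local_cone P x s -> chart (strata P) x (face s) r.
Proof.
move=> Xx; have [[_ lfC] _ _ _] := hC; have [U xU finU] := lfC x Xx.
pose good P r := forall v, `|v| < r -> P (x + v) ->
  P x /\ forall s, is_local_cone P x s -> chart (strata P) x (face s) r.
have goodP P : C P -> \forall r \near (0 : R)^'+, good P r.
  move=> CP; have [Px|nPx] := pselect (P x).
    have [s Ps] := chamber_locally_polyhedral CP Px.
    have [e ch] := strata_chart Ps.
    near=> r => v _ _; split => // s' Ps'.
    rewrite -(local_coneE Ps') (local_coneE Ps); apply: (chart_le _ _ ch) => //.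
    by near: r; apply: nbhs_right_le; exact: (chart_gt0 ch).
  have : ~ closure P x by move=> /(chamber_closed CP Xx).
  move=> /closure_normP/existsNP[e /not_implyP[e0 nP]].
  near=> r => v vr Pv; exfalso; apply: nP; exists v => //.
  by apply: (lt_trans vr); near: r; exact: nbhs_right_lt.
have allgood : \forall r \near (0 : R)^'+,
    forall P, C P -> P `&` U !=set0 -> good P r.
  have : \forall r \near (0 : R)^'+,
      forall P, [set P | C P /\ P `&` U !=set0] P -> good P r.
    by apply: near_finite => // P [CP _]; exact: goodP.
  by apply: filterS => r h P CP PU; exact: h.
have [e e0 eU] := (near0_normP _).1 ((nbhs0P _ _).1 xU).
near ((0 : R)^'+) => r; exists r => // P v CP vr Pv.
have gP : good P r.
  apply: (near allgood r) => //; exists (x + v); split => //; apply: eU.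
  by apply: (lt_le_trans vr); near: r; exact: nbhs_right_le.
exact: gP vr Pv.
Unshelve. all: by end_near. Qed.

Lemma decomposition_conical : conical_partition X S.
Proof.
have stratum_conn A : S A -> connected A.
  by move=> [P CP PA]; exact: (cell_connected (chamber_conical CP) PA).
split => //.
- split.
  + apply/seteqP; split=> x.
      move=> [A [P CP PA] Ax]; apply: (chamber_sub CP).
      exact: (cell_sub (chamber_conical CP) PA Ax).
    have [[CX _] _ _ _] := hC; rewrite -{1}CX => -[P CP Px].
    have [A PA Ax] := cell_ex (chamber_conical CP) Px.
    by exists A => //; exists P.
  + by move=> A B SA SB [z [Az Bz]]; exact: (decomposition_inj SA SB Az Bz).
  + by move=> A [P CP PA]; exact: (cell_neq0 (chamber_conical CP) PA).
move=> x Xx; have [r r0 rP] := chamber_ball Xx.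
exists (chamber_cones x), r; split => //; first exact: chamber_cones_fan.
- move=> A v SA vr Av; have [CA AA] := stratum_chamber SA.
  have Xv : X (x + v).
    have [P CP PA] := SA; apply: (chamber_sub CP).
    exact: (cell_sub (chamber_conical CP) PA Av).
  have [|Px ch] := rP _ v CA vr; first by split => //; exact: subset_closure.
  have [s Ps] := chamber_locally_polyhedral CA Px.
  have [_ _ /(_ A v AA vr Av)[f sf Af] _] := ch s Ps; exists f => //.
  apply: (fan_face (chamber_cones_fan Xx) _ sf).
  by exists (closure_in X A).
- move=> s [P [CP Px Ps]]; have hs : polyhedral_cone s by case: Ps.
  have [_ ch] : P x /\
      forall s, is_local_cone P x s -> chart (strata P) x (face s) r.
    by apply: (rP P 0) => //; rewrite ?normr0 ?addr0.
  have [_ _ _ /(_ s (face_refl hs))[A PA As]] := ch s Ps.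
  by exists A => //; exists P.
Qed.

Lemma closures_of_decomposition : closures_of_strata X S = C.
Proof.
apply/seteqP; split=> [_ [A SA <-]|P CP].
  by have [] := stratum_chamber SA.
by have [A PA PE] := chamber_closure CP; exists A => //; exists P.
Qed.

End ChamberDecompositions.

(** * The bijection *)

Lemma set_bij_inverse T U (A : set T) (B : set U) (f : T -> U) (g : U -> T) :
  (forall x, A x -> B (f x)) -> (forall y, B y -> A (g y)) ->
  (forall x, A x -> g (f x) = x) -> (forall y, B y -> f (g y) = y) ->
  set_bij A B f.
Proof.
move=> fB gA fK gK; split=> [x /fB//|x y /set_mem Ax /set_mem Ay fxy|y By].
  by rewrite -(fK x Ax) fxy fK.
by exists (g y); [exact: gA | exact: gK].
Qed.

Theorem theorem2p1 (R : realType) (V : normedVectType R) (X : set V)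
    (hX : closed_in_convex X) :
  [/\ set_bij (fan_stratifications X) (chamber_decompositions X)
        (closures_of_strata X),
      set_bij (chamber_decompositions X) (fan_stratifications X)
        strata_of_decomposition,
      (forall S, fan_stratifications X S ->
        strata_of_decomposition (closures_of_strata X S) = S) &
      (forall P, chamber_decompositions X P ->
        closures_of_strata X (strata_of_decomposition P) = P)].
Proof.
have toC S : fan_stratifications X S ->
    chamber_decompositions X (closures_of_strata X S).
  move=> hS; apply: closures_chamber_decomposition => //.
  exact: fan_stratification_conical.
have toS C : chamber_decompositions X C ->
    fan_stratifications X (strata_of_decomposition C).
  by move=> hC; apply: conical_fan_stratification; exact: decomposition_conical.
have SK S : fan_stratifications X S ->
    strata_of_decomposition (closures_of_strata X S) = S.
  by move=> hS; apply: strata_of_closures; exact: fan_stratification_conical.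
have CK C : chamber_decompositions X C ->
    closures_of_strata X (strata_of_decomposition C) = C.
  by move=> hC; exact: closures_of_decomposition.
split => //; first exact: (set_bij_inverse toC toS SK CK).
exact: (set_bij_inverse toS toC CK SK).
Qed.
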